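(* Suppose that $G$ is a finitely generated group with a fixed finite generating set $S$, $\Delta>0$, and $\mathcal H_n$ ($n\ge1$) is a sequence of geodesic spaces with $\Delta$-thin triangles. Suppose that $\rho_n:G\to\mathrm{Isom}(\mathcal H_n)$ is a sequence of representations which blows up. Let $K$ be the complete graph with vertex set $G$. Let $x_n\in\mathcal H_n$ be an approximate center of $\rho_n$, let $\iota_n:K\to\mathcal H_n$ be a $\rho_n$-equivariant straight map such that $\iota_n(g)=\rho_n(g)x_n$ for all $g\in G$, and let $d_n=\iota_n^*d_{\mathcal H_n}$. Then there is a subsequence, still denoted $\{\rho_n\}$, and $\lambda_n\to0$ such that $\lambda_n d_n$ converges pointwise to a pseudo-metric $\overline d$ on $K$. Furthermore, the metric space associated to $(K,\overline d)$ is an $\mathbb R$-tree $\Gamma$. The action of $G$ on $K$ covers an action $\sigma:G\to\mathrm{Isom}(\Gamma)$, and some element of $\sigma(G)$ is hyperbolic. Furthermore $\lim_{n\to\infty}L(\rho_n)=L(\sigma)$ in $\mathbb P\mathrm{LF}(G)$. Suppose, in addition, that $\sigma$ is irreducible and that $L(\sigma)$ takes values in $\mathbb Z$. Then the minimal $G$-invariant subtree of $\Gamma$ is a simplicial tree on which $G$ acts with the same length function as $\sigma$.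
   Context: A path-metric space is a metric space in which the distance between two points is the infimum of the lengths of paths joining them. A geodesic is an arc whose length equals the distance between its endpoints; a geodesic space is a path-metric space in which every pair of points is joined by a geodesic. A geodesic space has $\Delta$-thin triangles if for every triangle with geodesic sides each side is contained in the $\Delta$-neighborhood of the union of the other two. For an isometry $\tau$ of a metric space $X$, $t(\tau)=\inf\{d(x,\tau x):x\in X\}$; for an action $\rho:G\to\mathrm{Isom}(X)$, $L(\rho)(g)=t(\rho(g))$. The sequence $\rho_n$ blows up if there is $\alpha\in G$ with $\lim_{n\to\infty}t(\rho_n(\alpha))=\infty$. An approximate center of $\rho_n$ is a point $x\in\mathcal H_n$ with $r_S(x)\le r_S(y)+1$ for all $y\in\mathcal H_n$, where $r_S(x)=\max\{d(x,\rho_n(\alpha)x):\alpha\in S\}$. $G$ acts on the vertices of $K$ by left multiplication, and this is extended linearly over edges. A map from a graph to a geodesic space is straight if its restriction to each edge, identified affinely with $[0,1]$, is a constant-speed (possibly constant) geodesic, i.e. $d(f(s),f(t))=|s-t|\,d(f(0),f(1))$. The pullback pseudo-metric is $f^*d(x,y)=d(f(x),f(y))$. The metric space associated to a pseudo-metric space is its quotient identifying points at distance $0$. An $\mathbb R$-tree is a path-metric space in which any two points are the endpoints of a unique arc, and this arc is isometric to an interval in $\mathbb R$. An isometry $\tau$ of an $\mathbb R$-tree is hyperbolic if $t(\tau)>0$ and $\{x:d(x,\tau x)=t(\tau)\}$ is isometric to a line, called its axis. An action is irreducible if two elements of $G$ act as hyperbolics with disjoint axes. The minimal $G$-invariant subtree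 is the (unique) $G$-invariant subtree having no proper $G$-invariant subtree. $\mathrm{LF}(G)=\mathbb R^G$ with the product topology; $\mathbb P\mathrm{LF}(G)=(\mathrm{LF}(G)-0)/(\mathbb R-0)$ with the quotient topology; $L_n\to L$ in $\mathbb P\mathrm{LF}(G)$ means there are $\lambda_n\ne0$ with $\lambda_nL_n(g)\to L(g)$ for all $g\in G$. *)

(* Defs.v *)
From HB Require Import structures.
From mathcomp Require Import all_boot all_order all_algebra.
From mathcomp Require Import all_classical all_reals all_analysis.

Set Implicit Arguments.
Unset Strict Implicit.
Unset Printing Implicit Defensive.

Import Order.TTheory GRing.Theory Num.Theory.
Import numFieldNormedType.Exports.

Local Open Scope classical_set_scope.
Local Open Scope ring_scope.

Section Paths.
Context {R : realType} {X : metricType R}.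
Implicit Types (x y : X) (gamma : R -> X).

(* Paths are parametrized by [0, 1]; values of gamma elsewhere are ignored. *)
Definition path_between x y gamma : Prop :=
  [/\ {within `[0, 1], continuous gamma}, gamma 0 = x & gamma 1 = y].

Definition trace gamma : set X := gamma @` `[0, 1].

Definition path_length gamma : \bar R :=
  ereal_sup [set (\sum_(0 <= i < size s)
      mdist (gamma (nth 1 (0 :: s) i)) (gamma (nth 1 (0 :: s) i.+1)))%:E
    | s in itv_partition 0 1].

(* The second disjunct is the degenerate arc, reduced to the point x = y. *)
Definition arc_between x y gamma : Prop :=
  path_between x y gamma /\
  ({in `[0, 1] &, injective gamma} \/ {in `[0, 1], forall t, gamma t = x}).

Definition geodesic_between x y gamma : Prop :=
  arc_between x y gamma /\ path_length gamma = (mdist x y)%:E.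

End Paths.

Section MetricSpaces.
Context {R : realType}.
Implicit Types X : metricType R.

Definition path_metric_space X : Prop :=
  forall x y : X,
    (mdist x y)%:E = ereal_inf [set path_length gamma | gamma in path_between x y].

Definition geodesic_space X : Prop :=
  path_metric_space X /\
  forall x y : X, exists gamma, geodesic_between x y gamma.

(* One side is singled out: a triangle may be relabelled cyclically. *)
Definition thin_triangles (Delta : R) X : Prop :=
  forall (x y z : X) a b c,
    geodesic_between x y a -> geodesic_between y z b -> geodesic_between z x c ->
    forall p, trace a p ->
      exists2 q, (trace b `|` trace c) q & mdist p q <= Delta.

Definition isometric_to_interval X (A : set X) : Prop :=
  exists (a b : R) (f : R -> X),
    [/\ a <= b, {in `[a, b] &, forall s t, mdist (f s) (f t) = `|s - t|}
      & f @` `[a, b] = A].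

Definition isometric_to_line X (A : set X) : Prop :=
  exists f : R -> X,
    (forall s t, mdist (f s) (f t) = `|s - t|) /\ range f = A.

Definition R_tree X : Prop :=
  path_metric_space X /\
  forall x y : X, exists gamma,
    [/\ arc_between x y gamma,
        forall gamma', arc_between x y gamma' -> trace gamma' = trace gamma
      & isometric_to_interval (trace gamma)].

End MetricSpaces.

Section Subspace.
Context {R : realType} {X : metricType R} (A : set X).

Let sub_mdist (x y : A) : R := mdist (set_val x) (set_val y).

Let sub_mdist_ge0 x y : 0 <= sub_mdist x y.
Proof. exact: mdist_ge0. Qed.

Let sub_mdist_positivity x y : sub_mdist x y = 0 -> x = y.
Proof. by move/mdist_positivity/val_inj. Qed.

Let sub_ballEmdist (x : A) d : ball x d = [set y | sub_mdist x y < d].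
Proof.
rewrite (_ : ball x d = set_val @^-1` ball (set_val x) d) //.
by rewrite ballEmdist.
Qed.

HB.instance Definition _ := PseudoMetric_isMetric.Build R (set_type A)
  sub_mdist_ge0 sub_mdist_positivity sub_ballEmdist.

End Subspace.

Record pseudo_metric (R : realType) (T : Type) := PseudoMetricOn {
  pdist :> T -> T -> R;
  pdistxx : forall x, pdist x x = 0;
  pdist_sym : forall x y, pdist x y = pdist y x;
  pdist_triangle : forall y x z, pdist x z <= pdist x y + pdist y z }.

Section AssociatedMetricSpace.
Context {R : realType} {T : choiceType} (d : pseudo_metric R T).
Local Open Scope quotient_scope.

Lemma pdist_ge0 x y : 0 <= d x y.
Proof.
rewrite -(@pmulrn_lge0 _ _ 2)// -(pdistxx d x).
by rewrite (le_trans (pdist_triangle d y _ _))// (pdist_sym d y x) -mulr2n.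
Qed.

Definition pdist_zero : rel T := fun x y => d x y == 0.

Lemma pdist_zero_refl : reflexive pdist_zero.
Proof. by move=> x; rewrite /pdist_zero pdistxx. Qed.

Lemma pdist_zero_sym : symmetric pdist_zero.
Proof. by move=> x y; rewrite /pdist_zero pdist_sym. Qed.

Lemma pdist_zero_trans : transitive pdist_zero.
Proof.
move=> y x z /eqP xy /eqP yz; rewrite /pdist_zero eq_le pdist_ge0 andbT.
by rewrite (le_trans (pdist_triangle d y _ _))// xy yz addr0.
Qed.

Canonical pdist_zero_equiv :=
  EquivRel pdist_zero pdist_zero_refl pdist_zero_sym pdist_zero_trans.

Definition associated_space := {eq_quot pdist_zero}.

HB.instance Definition _ := EqQuotient.copy associated_space {eq_quot pdist_zero}.
HB.instance Definition _ := Choice.copy associated_space {eq_quot pdist_zero}.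

Definition quot_map (x : T) : associated_space := \pi x.

Let qdist (p q : associated_space) : R := d (repr p) (repr q).

Let qdistxx p : qdist p p = 0.
Proof. exact: pdistxx. Qed.

Let qdist_positivity p q : qdist p q = 0 -> p = q.
Proof.
by move=> /eqP pq; rewrite -[p]reprK -[q]reprK; apply/eqmodP; exact: pq.
Qed.

Let qdist_sym p q : qdist p q = qdist q p.
Proof. exact: pdist_sym. Qed.

Let qdist_triangle q p r : qdist p r <= qdist p q + qdist q r.
Proof. exact: pdist_triangle. Qed.

HB.instance Definition _ := isMetric.Build R associated_space
  qdistxx qdist_positivity qdist_sym qdist_triangle.

Lemma mdist_quot_map x y : mdist (quot_map x) (quot_map y) = d x y.
Proof.
have reprd z : d z (repr (quot_map z)) = 0.
  suff /eqmodP/eqP : z = repr (quot_map z) %[mod {eq_quot pdist_zero}] by [].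
  by rewrite [RHS]reprK.
have reprd' z : d (repr (quot_map z)) z = 0 by rewrite pdist_sym.
apply/eqP; rewrite eq_le; apply/andP; split.
- rewrite (le_trans (pdist_triangle d x _ _))// reprd' add0r.
  by rewrite (le_trans (pdist_triangle d y _ _))// reprd addr0.
- rewrite (le_trans (pdist_triangle d (repr (quot_map x)) _ _))// reprd add0r.
  by rewrite (le_trans (pdist_triangle d (repr (quot_map y)) _ _))// reprd' addr0.
Qed.

End AssociatedMetricSpace.

Arguments quot_map {R T} d x.

Section Graphs.
Context {R : realType} {V : eqType}.

(* (1 - t) u + t v in barycentric coordinates *)
Definition bary (u v : V) (t : R) : V -> R :=
  fun w => (1 - t) * (w == u)%:R + t * (w == v)%:R.

(* Points of the geometric realization are barycentric coordinate functions
   supported on a vertex or on an edge. *)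
Definition realization_set (e : rel V) : set (V -> R) :=
  [set b | exists u v t, [/\ u = v \/ e u v, t \in `[0, 1] & b = bary u v t]].

End Graphs.

Definition realization (R : realType) (V : eqType) (e : rel V) : choiceType :=
  set_type (@realization_set R V e).

Section StraightMaps.
Context {R : realType} {V : eqType} {e : rel V}.

Lemma vertex_subproof (v : V) : realization_set e (bary v v (0 : R)).
Proof.
by exists v, v, 0; split=> //; [left | rewrite in_itv/= lexx ler01].
Qed.

Definition vertex (v : V) : realization R e := exist (fun b => b \in realization_set e) (bary v v 0) (mem_set (vertex_subproof v)).

Definition straight (X : metricType R) (f : realization R e -> X) : Prop :=
  forall (u v : V) (s t : R) (p q : realization R e),
    e u v -> s \in `[0, 1] -> t \in `[0, 1] ->
    val p = bary u v s -> val q = bary u v t ->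
    mdist (f p) (f q) = `|s - t| * mdist (f (vertex u)) (f (vertex v)).

End StraightMaps.

Section Actions.
Context {R : realType} {G : groupType}.
Local Open Scope group_scope.

Definition generates (S : seq G) : Prop :=
  forall A : {pred G}, group_closed A -> {subset S <= A} -> A =i predT.

Definition isometric_action (X : metricType R) (rho : G -> X -> X) : Prop :=
  [/\ forall x, rho 1 x = x,
      forall g h x, rho (g * h) x = rho g (rho h x)
    & forall g x y, mdist (rho g x) (rho g y) = mdist x y].

Definition translation_length (X : metricType R) (tau : X -> X) : R :=
  inf [set mdist x (tau x) | x in [set: X]].

Definition length_function (X : metricType R) (rho : G -> X -> X) : G -> R :=
  fun g => translation_length (rho g).

Definition blows_up (X : nat -> metricType R) (rho : forall n, G -> X n -> X n) :
    Prop :=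
  exists alpha : G, (fun n => translation_length (rho n alpha)) @ \oo --> +oo%R.

Definition displacement (S : seq G) (X : metricType R) (rho : G -> X -> X)
    (x : X) : R :=
  \big[Num.max/0%R]_(alpha <- S) mdist x (rho alpha x).

Definition approximate_center (S : seq G) (X : metricType R)
    (rho : G -> X -> X) (x : X) : Prop :=
  forall y, (displacement S rho x <= displacement S rho y + 1)%R.

Definition characteristic_set (X : metricType R) (tau : X -> X) : set X :=
  [set x | mdist x (tau x) = translation_length tau].

Definition hyperbolic (X : metricType R) (tau : X -> X) : Prop :=
  (0 < translation_length tau)%R /\ isometric_to_line (characteristic_set tau).

Definition irreducible (X : metricType R) (sigma : G -> X -> X) : Prop :=
  exists g h : G,
    [/\ hyperbolic (sigma g), hyperbolic (sigma h)
      & characteristic_set (sigma g) `&` characteristic_set (sigma h) = set0].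

Definition subtree (X : metricType R) (T : set X) : Prop :=
  T !=set0 /\ R_tree (set_type T).

Definition invariant_set (X : metricType R) (sigma : G -> X -> X) (T : set X) : Prop :=
  forall g x, T x -> T (sigma g x).

Definition minimal_invariant_subtree (X : metricType R) (sigma : G -> X -> X)
    (T : set X) : Prop :=
  [/\ subtree T, invariant_set sigma T
    & forall T' : set X,
        subtree T' -> invariant_set sigma T' -> T' `<=` T -> T' = T].

(* Convergence of classes in (R^G - 0) / (R - 0). *)
Definition cvg_PLF (L_ : nat -> G -> R) (L : G -> R) : Prop :=
  [/\ forall n, exists g, L_ n g <> 0%R,
      exists g, L g <> 0%R
    & exists lambda : nat -> R, (forall n, lambda n <> 0%R) /\
        forall g, (fun n => (lambda n * L_ n g)%R) @ \oo --> L g].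

End Actions.

Section CompleteGraph.
Context {R : realType} {G : groupType}.

Definition complete_graph : rel G := fun g h => g != h.

(* Left multiplication on vertices, extended linearly: the coefficient of
   g p at h is the coefficient of p at g^-1 h. *)
Lemma left_mul_subproof (g : G) (p : realization R complete_graph) :
  realization_set complete_graph (fun h => val p (g^-1 * h)%g).
Proof.
case: p => b /=; rewrite inE => -[u [v [t [uv t01 ->]]]].
exists (g * u)%g, (g * v)%g, t; split=> //.
  case: uv => [->|uv]; [by left|right].
  by apply: contra_neq uv => /mulgI.
apply/funext => h; rewrite /bary.
have mulE w : (g^-1 * h == w)%g = (h == g * w)%g.
  by apply/eqP/eqP => [<-|->]; rewrite ?mulVKg ?mulKg.
by rewrite !mulE.
Qed.

Definition left_mul (g : G) (p : realization R complete_graph) :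
  realization R complete_graph := exist (fun b => b \in realization_set complete_graph)
    (fun h => val p (g^-1 * h)%g) (mem_set (left_mul_subproof g p)).

End CompleteGraph.

Definition graph_tree (V : eqType) (e : rel V) : Prop :=
  [/\ inhabited V, symmetric e, irreflexive e,
      forall u v, exists p, path e u p /\ last u p = v
    & forall c, ucycle e c -> (size c < 3)%N].

(* X is the geometric realization, via f, of the tree (V, e), all edges having
   the same length.  As arcs of an R-tree are isometric to intervals, the
   lengths of the edges determine the distance of X. *)
Definition simplicial_structure (R : realType) (X : metricType R) (V : eqType)
    (e : rel V) (f : realization R e -> X) : Prop :=
  [/\ graph_tree e, bijective f, straight f
    & exists2 c : R, 0 < c &
        forall u v, e u v -> mdist (f (vertex u)) (f (vertex v)) = c].

Definition simplicial_tree_action (R : realType) (G : groupType)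
    (X : metricType R) (tau : G -> X -> X) : Prop :=
  [/\ R_tree X, isometric_action tau
    & exists (V : eqType) (e : rel V) (f : realization R e -> X),
        simplicial_structure f /\
        forall g v, exists w, tau g (f (vertex v)) = f (vertex w)].

(* Main.v *)
(* Everything is expressed by the four-point inequality.  Thin triangles imply it with a
   constant 8 Delta; dividing the distances by the displacement of the approximate center,
   which tends to infinity, makes the constant vanish in the limit.  A point of an edge
   [u, v] satisfies d(x, w) = max(d(u, w) - d(u, x), d(v, w) - d(v, x)) up to that constant,
   so convergence on the countably many pairs of vertices implies convergence on K; likewise
   t(g) = max(0, d(x, g g x) - d(x, g x)) up to the constant, which gives the convergence of
   the length functions.  In the limit all pairs of points are joined by segments, and the
   four-point inequality with constant 0 then makes the space an R-tree.

   If no element were hyperbolic, d(x, g x) would be ultrametric in g and the generators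
   would have a common fixed point, whereas approximate centers force displacements at least 1.

   If the action is irreducible with integral lengths, the bridge between two disjoint axes
   has an endpoint o with all d(o, g o) integral.  The union of the segments [o, g o] is the
   minimal subtree, and its points at distance in Z/2 from o are the vertices of a simplicial
   structure with edges of length 1/2. *)

Require Import Defs.
From HB Require Import structures.
From mathcomp Require Import all_boot all_order all_algebra lra.
From mathcomp Require Import all_classical all_reals all_analysis.

Set Implicit Arguments.
Unset Strict Implicit.
Unset Printing Implicit Defensive.

Import Order.TTheory GRing.Theory Num.Theory.
Import numFieldNormedType.Exports.

Local Open Scope classical_set_scope.
Local Open Scope ring_scope.

(* The library states these over a [realFieldType]; restated over a [realType] so that
   all distances carry the same structure, as [mlra] compares them syntactically. *)
Lemma mdistC {R : realType} {X : metricType R} (x y : X) : mdist x y = mdist y x.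
Proof. exact: metric_sym. Qed.

Lemma mdist0 {R : realType} {X : metricType R} (x : X) : mdist x x = 0.
Proof. exact: mdistxx. Qed.

Lemma mdist_tri {R : realType} {X : metricType R} (x y z : X) :
  mdist x z <= mdist x y + mdist y z.
Proof. exact: metric_triangle. Qed.

Lemma mdist_le0_eq {R : realType} {X : metricType R} (x y : X) : mdist x y <= 0 -> x = y.
Proof.
by move=> h; apply: mdist_positivity; apply/eqP; rewrite eq_le h mdist_ge0.
Qed.

(* [lra] modulo symmetry and nonnegativity of the distance. *)
Ltac mlra :=
  repeat match goal with H : context [@mdist _ _ _ _] |- _ => revert H end;
  repeat match goal with |- context [@mdist ?K ?Y ?a ?b] =>
    first [ constr_eq a b; rewrite !(mdist0 a)
          | try rewrite !(mdistC b a); move: (@mdist_ge0 K Y a b);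
            let r := fresh "r" in generalize (@mdist K Y a b) => r ] end;
  move=> *; lra.

(** * The four-point inequality, betweenness and segments *)

Section FourPoint.
Context {R : realType} {X : metricType R}.
Implicit Types (x y z u v w m : X) (e : R).
Local Notation d := (@mdist R X).

(** Gromov hyperbolicity in a form without base point: of the three sums over opposite pairs, the
    two largest differ by at most [e]. The disjunction stands for a maximum. *)
Definition four_point e := forall x y z w,
  d x y + d z w <= d x z + d y w + e \/ d x y + d z w <= d x w + d y z + e.

Definition between x z y := d x z + d z y = d x y.

(** A segment without a parametrization: only the existence of a point at each distance is required.
    Continuity and uniqueness come later from [four_point X 0]. *)
Definition joined x y := forall t, 0 <= t <= d x y ->
  exists z, d x z = t /\ between x z y.

Lemma between_sym x z y : between x z y -> between y z x.
Proof. rewrite /between => h; mlra. Qed.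

Lemma betweenL x y : between x x y.
Proof. by rewrite /between mdist0 add0r. Qed.

Lemma betweenR x y : between x y y.
Proof. by rewrite /between mdist0 addr0. Qed.

(** This is the four-point inequality for the pairs [x], [w] and [u], [v], with [d u v] split at
    [x]. The triangle inequality gives the reverse bounds, so distances from [x] are determined up
    to [e] by those from [u] and [v]. *)
Lemma between_dist e u x v w : four_point e -> between u x v ->
  d x w <= d u w - d u x + e \/ d x w <= d v w - d v x + e.
Proof.
rewrite /between => h4 h; case: (h4 x w u v) => h'; [right|left]; mlra.
Qed.

Lemma joined_sym x y : joined x y -> joined y x.
Proof.
move=> xy t /andP[t0 tl]; have [|z [zt xzy]] := xy (d x y - t).
  by apply/andP; split; mlra.
exists z; split; last exact: between_sym.
by move: xzy; rewrite /between => xzy; mlra.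
Qed.

End FourPoint.

Arguments four_point {R} X e.

(** * Geometry of spaces satisfying the four-point inequality with constant 0 *)

Section ZeroHyperbolic.
Context {R : realType} {X : metricType R} (h4 : four_point X 0).
Implicit Types (x y z u v w m : X) (e : R).
Local Notation d := (@mdist R X).

(** The point [x] separates [u] from [v], so it also separates [w] from at least one of them. *)
Lemma between_case u x v w : between u x v -> between u x w \/ between v x w.
Proof.
move=> uxv; move: (mdist_tri u x w) (mdist_tri v x w).
by case: (between_dist w h4 uxv) => h ? ?; [left|right]; rewrite /between; mlra.
Qed.

Lemma between_inj u v x y : between u x v -> between u y v -> d u x = d u y ->
  x = y.
Proof.
move=> uxv; rewrite /between => uyv xy; apply: mdist_le0_eq; move: uxv (uxv).
by rewrite {1}/between => uxv /(between_dist y h4)[] h; mlra.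
Qed.

(** The threshold on [t] is the Gromov product of [y] and [z] based at [x]: up to it the segment
    from [x] to [z] follows the one to [y], beyond it the one from [z] to [y]. *)
Lemma joined_trans y x z : joined x y -> joined y z -> joined x z.
Proof.
move=> xy /joined_sym zy t /andP[t0 tl].
move: (mdist_tri x y z) (mdist_tri x z y) (mdist_tri y x z) => h1 h2 h3.
have [ts|st] := leP t ((d x y + d x z - d y z) / 2).
  have [|p [pt xpy]] := xy t; first by apply/andP; split; mlra.
  exists p; split=> //; move: xpy (between_dist z h4 xpy) (mdist_tri x p z).
  by rewrite /between => ? [?|?] ?; mlra.
have [|p [pt zpy]] := zy (d x z - t); first by apply/andP; split; mlra.
move: zpy (between_dist x h4 zpy) (mdist_tri x p z).
rewrite /between => zpy hh tri; exists p.
by case: hh => hh; split; rewrite /between; mlra.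
Qed.

Lemma tripod x y z : joined x y ->
  exists m, [/\ between x m y, between x m z & between y m z].
Proof.
move=> xy; move: (mdist_tri x y z) (mdist_tri x z y) (mdist_tri y x z) => h1 h2 h3.
have [|m [xm xmy]] := xy ((d x y + d x z - d y z) / 2).
  by apply/andP; split; mlra.
exists m; move: xmy (between_case z xmy).
by rewrite /between => ? [?|?]; split=> //; mlra.
Qed.

(** Let [U] be the set of points that are reached from [gamma a] through [m]. It is closed, and [U]
    without [m] is open; a path missing [m] would thus meet [U] in an open and closed part of its
    trace, containing [gamma b] but not [gamma a]. *)
Lemma path_covers (a b : R) (gamma : R -> X) m : a <= b ->
  {within `[a, b], continuous gamma} -> between (gamma a) m (gamma b) ->
  exists2 s, s \in `[a, b] & gamma s = m.
Proof.
move=> ab cgamma amb; apply: contrapT => hm.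
have {hm}hm s : s \in `[a, b] -> gamma s <> m by move=> ? ?; apply: hm; exists s.
have aa : a \in `[a, b] by rewrite in_itv/= lexx.
have bb : b \in `[a, b] by rewrite in_itv/= lexx ab.
set x := gamma a in amb *.
pose U := [set z | between x m z].
pose C := U `\ m.
have oC : open C.
  rewrite openE => z [Uz zm]; apply/nbhs_ballP; exists (d z m) => /=.
    by rewrite lt_neqAle mdist_ge0 andbT eq_sym; apply/eqP => /mdist_positivity.
  move=> z'; rewrite ballEmdist/= => zz'; split; last first.
    by move=> z'm; move: zz'; rewrite z'm ltxx.
  move: Uz; rewrite /U/= /between => Uz; move: (mdist_tri x m z') => h.
  by case: (h4 x z m z') => h'; mlra.
have oU : open (~` U).
  (* The radius is half the defect of the triangle inequality at [m], as moving [z] by [r] changes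
     this defect by at most [2 * r]. *)
  rewrite openE => z Uz; apply/nbhs_ballP; exists ((d x m + d m z - d x z) / 2) => /=.
    rewrite divr_gt0// subr_gt0 lt_neqAle mdist_tri andbT; apply/eqP => h.
    by apply: Uz; rewrite /U /between/= -h.
  move=> z'; rewrite ballEmdist/= => zz' Uz'; apply: Uz.
  move: Uz'; rewrite /U /between/= => Uz'.
  by move: (mdist_tri x z z') (mdist_tri m z' z) (mdist_tri x z' z) (mdist_tri m z z'); mlra.
have UC : gamma @` `[a, b] `&` U = gamma @` `[a, b] `&` C.
  apply/seteqP; split=> z [[s sab <-] Uz]; split=> //; try by exists s.
    by split=> //; exact: hm.
  by case: Uz.
have UT : gamma @` `[a, b] `&` U <> gamma @` `[a, b].
  move=> UE; have : (gamma @` `[a, b] `&` U) x by rewrite UE; exists a.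
  move=> [_]; rewrite /U /between/= mdist0 => h; apply: (hm a) => //.
  by apply: mdist_le0_eq; rewrite -/x; mlra.
apply: UT; apply: (connected_continuous_connected (@segment_connected R a b) cgamma).
- by exists (gamma b); split=> //; exists b.
- by exists C.
- by exists U => //; rewrite -[U]setCK; exact: open_closedC.
Qed.

End ZeroHyperbolic.

(** * From the four-point inequality to R-trees, and convex subsets as subtrees *)

Section RTrees.
Context {R : realType} {X : metricType R}.
Implicit Types (x y z u v w m : X) (e : R).
Local Notation d := (@mdist R X).

Lemma within_lipschitz (a b c : R) (gamma : R -> X) : 0 <= c ->
  {in `[a, b] &, forall s t, d (gamma s) (gamma t) <= c * `|s - t|} ->
  {within `[a, b], continuous gamma}.
Proof.
move=> c0 lip; have c1 : 0 < c + 1 by lra.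
 apply/subspace_continuousP => s sab.
apply/metricType_numDomainType.cvgrPdist_lt => e e0; rewrite near_withinE.
near=> t => tab; rewrite (le_lt_trans (lip s t sab tab))//.
rewrite (@le_lt_trans _ _ ((c + 1) * `|s - t|))//.
  by rewrite ler_wpM2r// lerDl.
rewrite mulrC -ltr_pdivlMr//; near: t.
exact: (nbhsx_ballx s _ (divr_gt0 e0 c1)).
Unshelve. all: by end_near. Qed.

Lemma path_length_ge (gamma : R -> X) :
  ((d (gamma 0) (gamma 1))%:E <= path_length gamma)%E.
Proof.
apply: ereal_sup_ubound; exists [:: 1]; last by rewrite /= big_nat1.
by split=> //=; rewrite ltr01.
Qed.

Lemma path_length_le (c : R) (gamma : R -> X) :
  {in `[0, 1] &, forall s t, s <= t -> d (gamma s) (gamma t) = c * (t - s)} ->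
  (path_length gamma <= c%:E)%E.
Proof.
move=> hg; apply: ge_ereal_sup => _ [s [ps /eqP ls] <-].
rewrite lee_fin.
suff H (a : R) : 0 <= a -> path <%O a s -> last a s = 1 ->
    \sum_(0 <= i < size s) d (gamma (nth 1 (a :: s) i)) (gamma (nth 1 (a :: s) i.+1))
    = c * (1 - a) by rewrite H// subr0 mulr1.
elim: s a {ps ls} => [|b s ih] a a0 /=.
  by move=> _ ->; rewrite big_nil subrr mulr0.
move=> /andP[ab pb] lb; rewrite big_nat_recl//= ih//; last by rewrite (le_trans a0)// ltW.
have b1 : b <= 1.
  by rewrite -lb; apply: (@itv_partition_le _ _ _ _ s); split.
rewrite hg ?in_itv/= ?a0 ?b1 ?(ltW ab) ?(le_trans a0 (ltW ab))//; first lra.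
by rewrite (le_trans (ltW ab)).
Qed.

(** Any choice of points at the prescribed distances from [x] is automatically isometric, by
    [between_case]. *)
Lemma joined_geodesic x y : joined x y -> four_point X 0 ->
  exists f : R -> X, [/\ f 0 = x, f (d x y) = y,
    {in `[0, d x y] &, forall s t, d (f s) (f t) = `|s - t|} &
    f @` `[0, d x y] = [set z | between x z y]].
Proof.
move=> xy h4.
have /choice[f fP] : forall t, exists z, t \in `[0, d x y] ->
    d x z = t /\ between x z y.
  move=> t; have [|tn] := boolP (t \in `[0, d x y]); last by exists x.
  by rewrite in_itv/= => /xy[z zt]; exists z.
have l0 := mdist_ge0 x y.
have in0 : 0 \in `[0, d x y] by rewrite in_itv/= lexx.
have inl : d x y \in `[0, d x y] by rewrite in_itv/= lexx l0.
have key s t : s \in `[0, d x y] -> t \in `[0, d x y] -> s <= t ->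
    d (f s) (f t) = t - s.
  move=> /fP[sx sb] /fP[tx tb] st.
  move: sb tb (between_case h4 (f s) tb); rewrite /between => ? ? [?|?]; mlra.
exists f; split.
- by have [h _] := fP _ in0; apply: mdist_le0_eq; rewrite mdistC h.
- have [h b] := fP _ inl; move: h b; rewrite /between => h b.
  by apply: mdist_le0_eq; mlra.
- move=> s t sin tin; have [st|/ltW ts] := leP s t.
    by rewrite key// distrC ger0_norm// subr_ge0.
  by rewrite mdistC key// ger0_norm// subr_ge0.
- apply/seteqP; split=> [_ [t tin <-]|z /= xzy]; first by have [] := fP _ tin.
  have zin : d x z \in `[0, d x y].
    rewrite in_itv/= mdist_ge0/=; move: xzy; rewrite /between => ?; mlra.
  exists (d x z) => //; have [h1 h2] := fP _ zin.
  exact: (between_inj h4 h2 xzy).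
Qed.

Lemma joined_geodesic01 x y : joined x y -> four_point X 0 ->
  exists gamma : R -> X, [/\ gamma 0 = x, gamma 1 = y,
    {in `[0, 1] &, forall s t, d (gamma s) (gamma t) = d x y * `|s - t|} &
    trace gamma = [set z | between x z y]].
Proof.
move=> xy h4; have [f [f0 fl fd fim]] := joined_geodesic xy h4.
have l0 := mdist_ge0 x y.
have inl (t : R) : t \in `[0, 1] -> d x y * t \in `[0, d x y].
  rewrite !in_itv/= => /andP[t0 t1]; apply/andP; split; first exact: mulr_ge0.
  by rewrite -[leRHS]mulr1 ler_wpM2l.
exists (fun t => f (d x y * t)); split; rewrite ?mulr0 ?mulr1//.
- move=> s t sin tin; rewrite fd ?inl//.
  by rewrite -mulrBr normrM ger0_norm.
- rewrite -fim; apply/seteqP; split=> [_ [t tin <-]|_ [u uin <-]].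
    by exists (d x y * t) => //; exact: inl.
  have [l_eq0|ln0] := eqVneq (d x y) 0.
    exists 0; first by rewrite /= in_itv/= lexx ler01.
    congr f; move: uin; rewrite /= in_itv/= => /andP[u0 ul].
    by rewrite mulr0; apply/eqP; rewrite eq_le u0 -l_eq0 ul.
  have lp : 0 < d x y by rewrite lt_neqAle eq_sym ln0.
  exists (u / d x y); last by rewrite mulrC divfK.
  move: uin; rewrite /= !in_itv/= => /andP[u0 ul].
  by rewrite divr_ge0//= ler_pdivrMr// mul1r.
Qed.

(** An arc covers the segment between its ends by [path_covers]; injectivity forbids it to leave the
    segment and come back. *)
Lemma R_tree_of_four_point :
  four_point X 0 -> (forall x y, joined x y) -> R_tree X.
Proof.
move=> h4 xy; have geo x y := joined_geodesic01 (xy x y) h4.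
have arcP x y gamma : gamma 0 = x -> gamma 1 = y ->
    {in `[0, 1] &, forall s t, d (gamma s) (gamma t) = d x y * `|s - t|} ->
    arc_between x y gamma.
  move=> g0 g1 gd; split.
    split=> //; apply: (@within_lipschitz _ _ (d x y)); first exact: mdist_ge0.
    by move=> s t sin tin; rewrite gd.
  have [l0|ln0] := eqVneq (d x y) 0; [right|left].
    move=> t tin; apply: mdist_le0_eq; rewrite -g0 gd ?l0 ?mul0r//.
    by rewrite in_itv/= lexx ler01.
  move=> s t sin tin st; apply/eqP; rewrite -subr_eq0 -normr_eq0.
  have := gd _ _ sin tin; rewrite st mdist0 => /esym/eqP.
  by rewrite mulf_eq0 (negbTE ln0).
split=> x y.
  apply/eqP; rewrite eq_le; apply/andP; split.
    by apply: le_ereal_inf_tmp => _ [gamma [_ <- <-] <-]; exact: path_length_ge.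
  have [gamma [g0 g1 gd _]] := geo x y.
  apply: (@le_trans _ _ (path_length gamma)).
    by apply: ereal_inf_lbound; exists gamma => //; have [] := arcP _ _ _ g0 g1 gd.
  apply: path_length_le => s t sin tin st.
  by rewrite gd// distrC ger0_norm// subr_ge0.
have [gamma [g0 g1 gd gtr]] := geo x y.
exists gamma; split; first exact: arcP.
  move=> gamma' [[cg' g'0 g'1] inj]; rewrite gtr; apply/seteqP; split; last first.
    move=> z /= xzy; have [|s sin <-] := path_covers h4 (ler01 : (0 : R) <= 1) cg' (m := z).
      by rewrite g'0 g'1.
    by exists s.
  move=> _ [s sin <-] /=; case: inj => [inj|cst]; last first.
    by rewrite cst//; exact: betweenL.
  (* Here [m] is the projection of [gamma' s] to the segment. The arc passes through [m] both before
     and after the parameter [s], so injectivity gives [gamma' s = m]. *)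
  have [m [xmy xmz ymz]] := tripod h4 (gamma' s) (xy x y).
  move: (sin); rewrite /= in_itv/= => /andP[s0 s1].
  have sub a b : 0 <= a -> b <= 1 -> `[a, b] `<=` (`[0, 1] : set R).
    move=> a0 b1 t; rewrite /= !in_itv/= => /andP[at_ tb].
    by rewrite (le_trans a0)//= (le_trans tb).
  have [|u uin um] := path_covers h4 s0 (continuous_subspaceW (sub _ _ (lexx _) s1) cg') (m := m).
    by rewrite g'0.
  have [|v vin vm] := path_covers h4 s1 (continuous_subspaceW (sub _ _ s0 (lexx _)) cg') (m := m).
    by rewrite g'1; exact: between_sym.
  have uv : u = v by apply: inj; rewrite ?um ?vm//; [exact: sub uin|exact: sub vin].
  move: uin vin; rewrite -uv !in_itv/= => /andP[_ us] /andP[su _].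
  have -> : s = u by apply/eqP; rewrite eq_le us su.
  by rewrite um.
have [f [_ _ fd fim]] := joined_geodesic (xy x y) h4.
by exists 0, (d x y), f; rewrite gtr; split=> //; exact: mdist_ge0.
Qed.

(** The tree structure of [T] supplies a path inside [T], and in [X] every path from [x] to [y]
    passes through all points between them. *)
Lemma subtree_between (T : set X) x y z : four_point X 0 -> R_tree (set_type T) ->
  T x -> T y -> between x z y -> T z.
Proof.
move=> h4 [_ tT] Tx Ty xzy.
have [gamma [[[cg g0 g1] _] _ _]] := tT (SigSub (mem_set Tx)) (SigSub (mem_set Ty)).
have cg' : {within `[0, 1], continuous (set_val \o gamma : R -> X)}.
  apply/subspace_continuousP => s sin.
  move/subspace_continuousP : cg => /(_ s sin) cg.
  apply: (continuous_cvg _ _ cg).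
  exact: initial_continuous.
have [|s sin <-] := path_covers h4 (ler01 : (0 : R) <= 1) cg' (m := z).
  by rewrite /= g0 g1.
by have := set_valP (gamma s).
Qed.

End RTrees.

Lemma subtree_of_convex (R : realType) (X : metricType R) (T : set X) :
  four_point X 0 -> (forall x y : X, joined x y) ->
  (forall x y z, T x -> T y -> between x z y -> T z) -> R_tree (set_type T).
Proof.
move=> h4 xy cT; apply: R_tree_of_four_point.
  by move=> x y z w; exact: h4.
move=> x y t tin; have [z [zt xzy]] := xy (set_val x) (set_val y) t tin.
have Tz : T z by apply: (cT _ _ _ _ _ xzy); exact: set_valP.
by exists (SigSub (mem_set Tz)).
Qed.

(** * Thin triangles imply the four-point inequality *)

Section ThinTriangles.
Context {R : realType} {X : metricType R}.
Implicit Types (x y z u v w m p q : X).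
Local Notation d := (@mdist R X).

Lemma geodesic_subadditive x y gamma (s t : R) : geodesic_between x y gamma ->
  0 <= s -> s <= t -> t <= 1 ->
  d x (gamma s) + d (gamma s) (gamma t) + d (gamma t) y <= d x y.
Proof.
move=> [[[_ <- <-] _] len] s0 st t1.
have H (r : seq R) : path <%O 0 r -> last 0 r = 1 ->
    \sum_(0 <= i < size r) d (gamma (nth 1 (0 :: r) i)) (gamma (nth 1 (0 :: r) i.+1))
    <= d (gamma 0) (gamma 1).
  move=> pr lr; rewrite -lee_fin -len; apply: ereal_sup_ubound.
  by exists r => //; split=> //; rewrite lr.
(* Partitions are strictly increasing, so coincidences among [0], [s], [t] and [1] call for shorter
   partitions. *)
have [s_eq0|sn0] := eqVneq s 0; have [t_eq1|tn1] := eqVneq t 1;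
  have [ste|stn] := eqVneq s t.
- by move: ste; rewrite s_eq0 t_eq1 => /eqP; rewrite eq_sym oner_eq0.
- by rewrite s_eq0 t_eq1 !mdist0 add0r addr0.
- by rewrite -ste s_eq0 !mdist0 !add0r.
- have := H [:: t; 1]; rewrite /= !big_nat_recl//= big_nil s_eq0 mdist0.
  rewrite add0r addr0; apply=> //; rewrite !lt_neqAle t1 -s_eq0 st stn.
  by rewrite tn1.
- by rewrite -ste ste t_eq1 !mdist0 !addr0.
- have := H [:: s; 1]; rewrite /= !big_nat_recl//= big_nil t_eq1 mdist0.
  rewrite !addr0; apply=> //; rewrite !lt_neqAle s0 -t_eq1 st stn.
  by rewrite eq_sym sn0.
- have := H [:: s; 1]; rewrite /= !big_nat_recl//= big_nil -ste mdist0.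
  rewrite !addr0; apply=> //; rewrite !lt_neqAle s0 ste t1 tn1 -ste.
  by rewrite eq_sym sn0.
- have := H [:: s; t; 1]; rewrite /= !big_nat_recl//= big_nil.
  rewrite addr0 addrA; apply=> //; rewrite !lt_neqAle s0 st t1 tn1 stn.
  by rewrite eq_sym sn0.
Qed.

Lemma geodesic_trace_between x y gamma p : geodesic_between x y gamma ->
  trace gamma p -> between x p y.
Proof.
move=> g [s /=]; rewrite in_itv/= => /andP[s0 s1] <-.
have := geodesic_subadditive g s0 (lexx s) s1; rewrite mdist0 addr0 => h.
by apply/eqP; rewrite eq_le h mdist_tri.
Qed.

(** Let [s] be the supremum of the parameters whose points are [Delta]-close to the side from [z] to
    [x]. By continuity [gamma s] is within [2 * Delta] of both other sides, so a detour through it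
    costs at most [4 * Delta]. *)
Lemma thin_projection (Delta : R) x y z gamma : 0 < Delta -> geodesic_space X ->
  thin_triangles Delta X -> geodesic_between x y gamma ->
  exists2 s, 0 <= s <= 1 &
    d x (gamma s) + d (gamma s) z <= d x z + 4 * Delta /\
    d y (gamma s) + d (gamma s) z <= d y z + 4 * Delta.
Proof.
move=> D0 [_ geo] thin g; have [b gb] := geo y z; have [c gc] := geo z x.
have [[[cg g0 g1] _] _] := g.
have [[[_ b0 _] _] _] := gb; have [[[_ _ c1] _] _] := gc.
pose A := [set t | 0 <= t <= 1 /\ exists2 q, trace c q & d (gamma t) q <= Delta].
have A0 : A 0.
  split; first by rewrite lexx ler01.
  exists x; last by rewrite g0 mdist0 ltW.
  by exists 1 => //=; rewrite in_itv/= lexx ler01.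
have A1 t : A t -> t <= 1 by move=> [/andP[]].
have sA : has_sup A by split; [exists 0|exists 1].
set s := sup A.
have s0 : 0 <= s by apply: ub_le_sup => //; have [] := sA.
have s1 : s <= 1 by apply: ge_sup => //; exists 0.
have sin : s \in `[0, 1] by rewrite in_itv/= s0 s1.
have [e e0 eP] : exists2 e : R, 0 < e & forall t, 0 <= t <= 1 -> `|s - t| < e ->
    d (gamma s) (gamma t) < Delta.
  move/subspace_continuousP : cg => /(_ s sin).
  move=> /metricType_numDomainType.cvgrPdist_lt /(_ _ D0).
  rewrite near_withinE => /nbhs_ballP[e /= e0 he]; exists e => // t tin ts.
  by apply: he; rewrite ?in_itv.
exists s; first by rewrite s0 s1.
have nearc : exists2 q, between z q x & d (gamma s) q <= 2 * Delta.
  have [t At st] := sup_adherent e0 sA.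
  have [tin [q cq tq]] := At.
  exists q; first exact: geodesic_trace_between cq.
  have : d (gamma s) (gamma t) < Delta.
    apply: eP => //; rewrite ger0_norm ?subr_ge0; last by apply: ub_le_sup => //; have [] := sA.
    by move: st; rewrite -/s => st; lra.
  by move: (mdist_tri (gamma s) (gamma t) q) => ? ?; mlra.
have nearb : exists2 q, between y q z & d (gamma s) q <= 2 * Delta.
  have [se1|sn1] := eqVneq s 1.
    by exists y; [exact: betweenL|rewrite se1 g1 mdist0 mulr_ge0// ltW].
  have s_lt1 : s < 1 by rewrite lt_neqAle sn1.
  (* A parameter just past [s], kept inside the unit interval. Its point is close to one of the two
     other sides, and not to the side [c], since then [t] would belong to [A]. *)
  pose t := Num.min 1 (s + e / 2).
  have st : s < t by rewrite lt_min s_lt1 ltrDl divr_gt0.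
  have tin : 0 <= t <= 1 by rewrite ge_min lexx/= (le_trans s0)// ltW.
  have tse : t <= s + e / 2 by rewrite ge_min lexx orbT.
  have sg : d (gamma s) (gamma t) < Delta.
    by apply: eP => //; rewrite ltr0_norm; lra.
  have [q [bq|cq] tq] := thin _ _ _ _ _ _ g gb gc (gamma t) (ex_intro2 _ _ t tin erefl).
    exists q; first exact: geodesic_trace_between bq.
    by move: (mdist_tri (gamma s) (gamma t) q) => ?; mlra.
  suff : t <= s by rewrite leNgt st.
  apply: ub_le_sup; first by have [] := sA.
  by split=> //; exists q.
move: nearb nearc => [q1 h1 k1] [q2 h2 k2].
move: h1 h2; rewrite /between => h1 h2.
move: (mdist_tri x q2 (gamma s)) (mdist_tri z q2 (gamma s)) (mdist_tri y q1 (gamma s))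
  (mdist_tri z q1 (gamma s)) => ? ? ? ?.
by split; mlra.
Qed.

(** Both [z] and [w] are projected to a geodesic from [x] to [y]; the order of the projections
    selects the alternative, and each projection contributes [4 * Delta]. *)
Lemma thin_four_point (Delta : R) : 0 < Delta -> geodesic_space X ->
  thin_triangles Delta X -> four_point X (8 * Delta).
Proof.
move=> D0 geo thin x y z w; have [gamma g] := geo.2 x y.
have [s /andP[s0 s1] [xs ys]] := thin_projection z D0 geo thin g.
have [t /andP[t0 t1] [xt yt]] := thin_projection w D0 geo thin g.
move: (mdist_tri z (gamma s) w) (mdist_tri (gamma s) (gamma t) w) => h1 h2.
move: (mdist_tri x (gamma s) y) (mdist_tri x (gamma t) y) => h3 h4.
have [st|/ltW ts] := leP s t; [right|left].
  by move: (geodesic_subadditive g s0 st t1) => ?; mlra.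
by move: (geodesic_subadditive g t0 ts s1) => ?; mlra.
Qed.

End ThinTriangles.

(** * Translation length in terms of the first two iterates of one point *)

Section TranslationLength.
Context {R : realType} {X : metricType R} (tau : X -> X).
Context (tauE : forall x y, mdist (tau x) (tau y) = mdist x y).
Implicit Types (x y z u v w m p q : X).
Local Notation d := (@mdist R X).

Lemma translation_length_le x : translation_length tau <= d x (tau x).
Proof.
by apply: ge_inf; [exists 0 => _ [y _ <-]; exact: mdist_ge0|exists x].
Qed.

Lemma translation_length_ge x (c : R) : (forall y, c <= d y (tau y)) ->
  c <= translation_length tau.
Proof.
by move=> h; apply: lb_le_inf; [exists (d x (tau x)), x|move=> _ [y _ <-]].
Qed.

(** The four points are [x], [tau (tau x)], [tau x] and [tau y]. As the left side is independent of
    [y], this bounds the translation length from below. *)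
Lemma displacement_ge (e : R) x y : four_point X e ->
  d x (tau (tau x)) - d x (tau x) - e <= d y (tau y).
Proof.
move=> h4; move: (tauE x y) (tauE (tau x) y) (tauE x (tau x)) (tauE y (tau y)) => h1 h2 h3 h5.
move: (tauE (tau x) (tau y)) => h6.
move: (mdist_tri x y (tau y)) (mdist_tri (tau x) (tau y) y) => h7 h8.
by case: (h4 x (tau (tau x)) (tau x) (tau y)) => h; mlra.
Qed.

(** The point [tau m] is the midpoint of [tau x] and [tau (tau x)]. Applying [between_dist] at [m],
    and if necessary at [tau m], bounds [d m (tau m)] by the orbit of [x], with an error [e] each
    time. *)
Lemma midpoint_displacement (e : R) x m : four_point X e ->
  between x m (tau x) -> d x m = d x (tau x) / 2 ->
  d m (tau m) <= Num.max 0 (d x (tau (tau x)) - d x (tau x)) + 2 * e.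
Proof.
move=> h4 b hm; move: (b); rewrite /between => b'.
have b2 : between (tau x) (tau m) (tau (tau x)) by rewrite /between !tauE.
have tm := tauE x m; have tx := tauE x (tau x); have tm' := tauE (tau x) m.
have [M0 M1] : 0 <= Num.max 0 (d x (tau (tau x)) - d x (tau x)) /\
    d x (tau (tau x)) - d x (tau x) <= Num.max 0 (d x (tau (tau x)) - d x (tau x)).
  by rewrite !le_max !lexx orbT.
move: (Num.max _ _) M0 M1 => M M0 M1.
have e0 : 0 <= e by case: (h4 x x x x); rewrite mdist0; lra.
case: (between_dist (tau m) h4 b) => h; last mlra.
by case: (between_dist x h4 b2) => h'; mlra.
Qed.

Lemma translation_length_bounds (e : R) x m : four_point X e ->
  between x m (tau x) -> d x m = d x (tau x) / 2 ->
  Num.max 0 (d x (tau (tau x)) - d x (tau x)) - e <= translation_length tau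
    <= Num.max 0 (d x (tau (tau x)) - d x (tau x)) + 2 * e.
Proof.
move=> h4 b hm; rewrite (le_trans (translation_length_le m))/=; last first.
  exact: midpoint_displacement.
rewrite andbT.
have e0 : 0 <= e by case: (h4 x x x x); rewrite mdist0; lra.
apply: (translation_length_ge m) => y; move: (displacement_ge x y h4).
rewrite maxEle; case: ifP => _ ?; last by mlra.
by mlra.
Qed.

(** With constant 0 the two bounds coincide, and the midpoint of [x] and [tau x] attains the
    infimum. *)
Lemma translation_length_tree x : four_point X 0 -> joined x (tau x) ->
  translation_length tau = Num.max 0 (d x (tau (tau x)) - d x (tau x)) /\
  exists m, between x m (tau x) /\ d m (tau m) = translation_length tau.
Proof.
move=> h4 xt; have [|m [mt b]] := xt (d x (tau x) / 2).
  by rewrite divr_ge0 ?mdist_ge0//=; move: (mdist_ge0 x (tau x)) => ?; lra.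
have := translation_length_bounds h4 b mt.
rewrite mulr0 subr0 addr0 -eq_le => /eqP E; split=> //; exists m; split=> //.
apply/eqP; rewrite eq_le translation_length_le andbT.
by have := midpoint_displacement h4 b mt; rewrite mulr0 addr0 E.
Qed.

End TranslationLength.

(** * Isometric actions on trees: axes of hyperbolic elements, common fixed points *)

Section TreeActions.
Context {R : realType} {G : groupType} {X : metricType R} (sigma : G -> X -> X).
Context (h4 : four_point X 0) (hj : forall x y : X, joined x y).
Arguments hj : clear implicits.
Context (sigmaA : isometric_action sigma).
Implicit Types (x y z u v w m o p q : X) (g h : G).
Local Notation d := (@mdist R X).

Lemma act1 x : sigma 1%g x = x.
Proof. by case: sigmaA. Qed.

Lemma actM g h x : sigma (g * h)%g x = sigma g (sigma h x).
Proof. by case: sigmaA. Qed.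

Lemma actd g x y : d (sigma g x) (sigma g y) = d x y.
Proof. by case: sigmaA. Qed.

Lemma actVK g x : sigma g (sigma g^-1%g x) = x.
Proof. by rewrite -actM mulgV act1. Qed.

Lemma actdV g x y : d (sigma g^-1%g x) y = d x (sigma g y).
Proof. by rewrite -(actd g) actVK. Qed.

Lemma actdVr g x y : d x (sigma g^-1%g y) = d (sigma g x) y.
Proof. by rewrite mdistC actdV mdistC. Qed.

Lemma translation_length_act g x : translation_length (sigma g) =
  Num.max 0 (d x (sigma g (sigma g x)) - d x (sigma g x)).
Proof. by have [] := translation_length_tree (actd g) h4 (hj x (sigma g x)). Qed.

Lemma translation_lengthE g x : d x (sigma g (sigma g x)) = 2 * d x (sigma g x) ->
  translation_length (sigma g) = d x (sigma g x).
Proof.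
by move=> h; rewrite (translation_length_act g x) h mulr2n mulrDl mul1r addrK max_r// mdist_ge0.
Qed.

Lemma translation_length_gt0 g x : 0 < translation_length (sigma g) ->
  d x (sigma g (sigma g x)) = d x (sigma g x) + translation_length (sigma g).
Proof.
rewrite (translation_length_act g x) lt_max ltxx/= => h.
by rewrite max_r ?(ltW h)//; lra.
Qed.

Section Axis.
Context (g : G).
Let t := translation_length (sigma g).
Context (t_gt0 : 0 < t).

Let P (k : nat) x := sigma (g ^+ k)%g x.
Let M (k : nat) x := sigma (g ^+ k)^-1%g x.

Let PS k x : P k.+1 x = sigma g (P k x).
Proof. by rewrite /P expgS actM. Qed.

Let PD k l x : P (k + l) x = P k (P l x).
Proof. by rewrite /P expgnDr actM. Qed.

(** Local geodesics in a tree are geodesics: the four points [p], [g p], [g^(k+2) p] and [g^(k+3) p]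
    extend the equality by one step. *)
Lemma dist_axis_pow p k : d p (sigma g p) = t -> d p (sigma (g ^+ k)%g p) = k%:R * t.
Proof.
(* The induction carries two consecutive powers, since the first step rests on
   [translation_length_gt0] and the later ones on the previous equality. *)
move=> pt; suff : d p (P k.+1 p) = k.+1%:R * t /\ d p (P k p) = k%:R * t by case.
elim: k => [|k [ih1 ih2]].
  by rewrite /P expg1 expg0 act1 mdist0 mul0r mul1r.
split=> //; case: k ih1 ih2 => [|k] ih1 ih2.
  rewrite /P expgS expg1 actM translation_length_gt0// pt -/t.
  by rewrite [RHS]mulr_natl.
have e1 : d (sigma g p) (P k.+2 p) = k.+1%:R * t by rewrite PS actd.
have e2 : d (sigma g p) (P k.+3 p) = k.+2%:R * t by rewrite PS actd.
have e3 : d (P k.+2 p) (P k.+3 p) = t.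
  by rewrite -[k.+3]addn1 PD actd /P expg1.
have k0 : 0 <= k%:R * t by rewrite mulr_ge0// ltW.
move: e1 e2 e3 ih1; rewrite -!natr1 !mulrDl !mul1r => e1 e2 e3 ih1.
move: (mdist_tri p (P k.+2 p) (P k.+3 p)) => h.
by case: (h4 p (P k.+2 p) (sigma g p) (P k.+3 p)) => h'; mlra.
Qed.

Let MP k x y : d (M k x) y = d x (P k y).
Proof. exact: actdV. Qed.

Let Mg k x : sigma g (M k.+1 x) = M k x.
Proof. by rewrite /M -actM expgSr invgM mulgA mulgV mul1g. Qed.

(** Translating [q] by more than [d p q] in the two directions of the axis brings its images to
    opposite sides of [p]. *)
Lemma axis_between p q N : d p (sigma g p) = t -> d p q < N%:R * t ->
  between (sigma (g ^+ N)^-1%g q) p (sigma (g ^+ N)%g q).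
Proof.
move=> pt Npq; have pN : d p (P N p) = N%:R * t by exact: dist_axis_pow.
rewrite -/(M N q) -/(P N q).
have pNN : d p (P (N + N) p) = (N + N)%:R * t by exact: dist_axis_pow.
have e1 : d (M N p) p = N%:R * t by rewrite MP.
have e2 : d (M N p) (P N p) = N%:R * t + N%:R * t.
  by rewrite MP -PD pNN natrD mulrDl.
have e3 : d (M N p) (M N q) = d p q by exact: actd.
have e4 : d (P N p) (P N q) = d p q by exact: actd.
have b : between (M N p) p (P N p) by rewrite /between e1 pN e2.
have b2 : between (M N q) p (P N p).
  have [b2|b2] := between_case h4 (M N q) b; move: b2; rewrite /between.
    by move=> b2; mlra.
  by move=> b2; mlra.
have [//|b3] := between_case h4 (P N q) b2.
by move: b3; rewrite /between => ?; mlra.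
Qed.

Let dist_pos u v x y : between u x v -> between u y v -> d x y = `|d u x - d u y|.
Proof.
move=> uxv uyv; have : d x y = d u x - d u y \/ d x y = d u y - d u x.
  move: (uxv) (uyv); rewrite /between => h1 h2.
  by have [] := between_case h4 y uxv; rewrite /between => h; [right|left]; mlra.
by move: (mdist_ge0 x y) => ge0 [] h; rewrite h in ge0 *;
  [rewrite ger0_norm|rewrite distrC ger0_norm].
Qed.

(** The axis is the increasing union of the segments from [M N m] to [P N m], where [m] is a point
    moved by exactly [t]. *)
Lemma hyperbolic_act : hyperbolic (sigma g).
Proof.
split=> //.
(* On an empty space the infimum would be [inf set0 = 0], against [t_gt0]. *)
have [x0 _] : exists x : X, True.
  apply: contrapT => noX.
  suff : ~ (0 < translation_length (sigma g)) by apply; exact: t_gt0.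
  rewrite /translation_length.
  have -> : [set d x (sigma g x) | x in [set: X]] = set0.
    by apply/seteqP; split=> // y [x]; case: noX; exists x.
  by rewrite inf0 ltxx.
have [_ [m [_ mt]]] := translation_length_tree (actd g) h4 (hj x0 (sigma g x0)).
(* [Q r z N] says that [z] has signed coordinate [r] on the segment from [M N m] to [P N m], with
   origin [m]; by [Qup] this persists when [N] grows. *)
pose Q r z N := between (M N m) z (P N m) /\ d (M N m) z = N%:R * t + r.
have dAB N : d (M N m) (P N m) = N%:R * t + N%:R * t.
  by rewrite MP -PD dist_axis_pow// natrD mulrDl.
have dAA N k : d (M (N + k) m) (M N m) = k%:R * t.
  rewrite /M [(N + k)%N]addnC expgnDr invgM actM actd.
  by rewrite mdistC -/(M k m) mdistC MP dist_axis_pow.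
have dBB N k : d (P (N + k) m) (P N m) = k%:R * t.
  by rewrite PD actd mdistC dist_axis_pow.
have Qup r z N k : Q r z N -> Q r z (N + k)%N.
  rewrite /Q /between !dAB natrD mulrDl => -[].
  move: (dAA N k) (dBB N k) (mdist_tri (M (N + k) m) (M N m) z) (mdist_tri (P (N + k) m) (P N m) z).
  by move: (mdist_tri (M (N + k) m) z (P (N + k) m)); rewrite dAB natrD mulrDl => *; split; mlra.
have large (r : R) : exists N, r < N%:R * t.
  exists (Num.truncn `|r / t|).+1; rewrite -ltr_pdivrMr//.
  by rewrite (le_lt_trans (ler_norm _))// truncnS_gt.
have /choice[f fP] : forall r, exists z, exists N0, forall k, Q r z (N0 + k)%N.
  move=> r; have [N Nr] := large `|r|.
  have [|z [zr zb]] := hj (M N m) (P N m) (N%:R * t + r).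
    move: Nr; rewrite dAB ltr_norml => /andP[Nr1 Nr2]; apply/andP; split; lra.
  by exists z, N => k; apply: Qup.
exists f.
have fd r r' : d (f r) (f r') = `|r - r'|.
  have [N hN] := fP r; have [N' hN'] := fP r'.
  have [b e] := hN N'; have [b' e'] := hN' N.
  move: b' e'; rewrite addnC => b' e'.
  rewrite (dist_pos b b') e e'; congr `|_|; lra.
split=> //; apply/seteqP; split=> [_ [r _ <-]|p /= pt].
  rewrite /characteristic_set/=.
  have [N hN] := fP r; have [b e] := hN 1%N.
  have [b' e'] := hN 2%N; have [b0 e0] := hN 0%N; move: b e b' e' b0 e0.
  rewrite addn2 addn1 addn0 => b e b' e' b0 e0.
  have gA : d (M N.+1 m) (sigma g (f r)) = d (M N.+2 m) (f r) by rewrite -Mg actd.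
  have gB : d (P N.+1 m) (sigma g (f r)) = d (P N m) (f r) by rewrite PS actd.
  have b2 : between (M N.+1 m) (sigma g (f r)) (P N.+1 m).
    rewrite /between gA e' mdistC gB dAB.
    move: b0; rewrite /between e0 dAB => b0; move: b0 gB.
    by rewrite -!natr1 !mulrDl !mul1r => *; mlra.
  rewrite (dist_pos b b2) gA e e' -!natr1 !mulrDl !mul1r distrC.
  by rewrite (_ : _ - _ = t) ?gtr0_norm//; lra.
(* Conversely, a point moved by [t] lies on these segments as soon as [N%:R * t] exceeds its
   distance to [m]. *)
have [N Np] := large (d p m).
have Q0 : Q (d (M N m) p - N%:R * t) p N.
  by split; [exact: axis_between|lra].
exists (d (M N m) p - N%:R * t) => //.
have [N' hN'] := fP (d (M N m) p - N%:R * t).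
have [b e] := hN' N; have [b' e'] := Qup _ _ _ N' Q0.
move: b e; rewrite addnC => b e.
by apply: (between_inj h4 b b'); rewrite e e'.
Qed.

End Axis.

(* If [d x (g h x)] exceeded the maximum, then [g h] would satisfy
   [d x ((g h)^2 x) > d x (g h x)], hence be hyperbolic. *)
Lemma ultrametric_of_elliptic g h x :
  (forall k, translation_length (sigma k) = 0) ->
  d x (sigma (g * h)%g x) <= Num.max (d x (sigma g x)) (d x (sigma h x)).
Proof.
move=> t0; rewrite leNgt gt_max; apply/negP => /andP[lg lh].
(* Translation length 0 means that the square of [k] moves [x] no farther than [k] does. *)
have sq k : d (sigma k^-1%g x) (sigma k x) <= d x (sigma k x).
  rewrite actdV; have := t0 k; rewrite (translation_length_act k x) => hk.
  have : d x (sigma k (sigma k x)) - d x (sigma k x) <= 0 by rewrite -hk le_max lexx orbT.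
  by rewrite subr_le0.
have Vd k : d x (sigma k^-1%g x) = d x (sigma k x) by rewrite mdistC actdV.
have := Vd (g * h)%g; have := Vd h; have := Vd g.
have := sq (g * h)%g; have := sq h; have := sq g.
set a := sigma g x; set a' := sigma g^-1%g x; set b := sigma h x.
set b' := sigma h^-1%g x; set c := sigma (g * h)%g x; set c' := sigma (g * h)^-1%g x.
move=> ha hb hc va vb vc.
have ac : d a c = d x b by rewrite /c actM actd.
have b'c' : d b' c' = d x a by rewrite /b' /c' invgM actM actd Vd.
have a'b : d a' b = d x c by rewrite actdV /c actM.
move: lg lh; rewrite -/a -/b -/c => lg lh.
(* In turn, [d a b] and [d a b'] are at least [d x c], then [d b' c] is greater than [d x c], which
   the last instance excludes. *)
case: (h4 a' b x a) => h1; last by mlra.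
case: (h4 a b x b') => h2; first by mlra.
case: (h4 a b' x c) => h3; last by mlra.
by case: (h4 b' c x c') => h5; mlra.
Qed.

Lemma exists_max_seq (T : eqType) (l : T -> R) (r : seq T) : r != [::] ->
  exists2 a, a \in r & forall b, b \in r -> l b <= l a.
Proof.
elim: r => [//|a r ih] _; have [->|/ih[b br bP]] := eqVneq r [::].
  by exists a; rewrite ?inE// => b; rewrite inE => /eqP ->.
have [ab|ba] := leP (l a) (l b).
  exists b; rewrite ?inE ?br ?orbT// => c; rewrite inE => /predU1P[->//|]; exact: bP.
exists a; rewrite ?inE ?eqxx// => c; rewrite inE => /predU1P[->//|/bP cb].
by rewrite (le_trans cb)// ltW.
Qed.

(* The midpoint of the longest of the segments [x, a x] is fixed. *)
Lemma common_fixed_point (r : seq G) x :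
  (forall k, translation_length (sigma k) = 0) ->
  exists m, forall g, g \in r -> sigma g m = m.
Proof.
move=> t0; have [->|/exists_max_seq] := eqVneq r [::]; first by exists x.
move=> /(_ (fun g => d x (sigma g x)))[a ar amax].
have [|m [xm b]] := hj x (sigma a x) (d x (sigma a x) / 2).
  by rewrite divr_ge0 ?mdist_ge0//=; move: (mdist_ge0 x (sigma a x)) => ?; lra.
exists m => g /amax ga; apply: mdist_le0_eq.
have um := fun g h => @ultrametric_of_elliptic g h x t0.
have aV : d x (sigma a^-1%g x) = d x (sigma a x) by rewrite mdistC actdV.
(* The points [x], [a x], [g x] and [g a x] are pairwise at distance at most [d x (sigma a x)],
   which forces the segments from [x] to [a x] and from [g x] to [g a x] to share their midpoint. *)
have c1 : d x (sigma g (sigma a x)) <= d x (sigma a x).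
  by rewrite -actM (le_trans (um _ _))// ge_max ga lexx.
have c2 : d (sigma a x) (sigma g x) <= d x (sigma a x).
  by rewrite -actdVr -actM (le_trans (um _ _))// aV ge_max ga lexx.
have c3 : d (sigma a x) (sigma g (sigma a x)) <= d x (sigma a x).
  rewrite -actdVr -(actM g a) -actM (le_trans (um _ _))// aV ge_max lexx/=.
  by rewrite actM.
have bg : between (sigma g x) (sigma g m) (sigma g (sigma a x)).
  by move: b; rewrite /between !actd.
have gm := actd g x m; have gam := actd g (sigma a x) m.
move: (b); rewrite /between => b'.
case: (between_dist (sigma g m) h4 b) => h.
  by case: (between_dist x h4 bg) => h'; mlra.
by case: (between_dist (sigma a x) h4 bg) => h'; mlra.
Qed.

End TreeActions.

(** * Projection of a point to a line *)

Section Projection.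
Context {R : realType} {X : metricType R}.
Context (h4 : four_point X 0) (hj : forall x y : X, joined x y).
Implicit Types (x y z u v w m o p q : X).
Local Notation d := (@mdist R X).

(** The point [o] is the center of the tripod on [p], [f (- L)] and [f L]. Taking [L] greater than
    [d p (f 0)] puts [o] strictly between [f (- L)] and [f L], so the points of the line outside
    this segment are also reached through [o]. *)
Lemma line_projection (A : set X) p : isometric_to_line A ->
  exists2 o, A o & forall w, A w -> d p w = d p o + d o w.
Proof.
move=> [f [fd fA]]; have f_in r : A (f r) by rewrite -fA; exists r.
have [L LE] : exists L, L = d p (f 0) + 1 by exists (d p (f 0) + 1).
have L0 : 0 < L by rewrite LE ltr_wpDl ?mdist_ge0.
have dAB : d (f (- L)) (f L) = 2 * L.
  by rewrite fd -opprD normrN gtr0_norm ?addr_gt0//; lra.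
have [ o [AoB Aop Bop]] := tripod h4 p (@hj (f (- L)) (f L)).
have oL : d (f (- L)) o <= 2 * L by move: AoB; rewrite /between => ?; mlra.
have [r rE] : exists r, r = d (f (- L)) o - L by exists (d (f (- L)) o - L).
have Er : d (f (- L)) (f r) = d (f (- L)) o.
  by rewrite fd rE distrC opprK subrK ger0_norm// mdist_ge0.
have BEr : d (f r) (f L) = L - r.
  by rewrite fd distrC ger0_norm// subr_ge0 rE; lra.
have of_ : o = f r.
  apply: (between_inj h4 AoB) => //; rewrite /between Er BEr dAB rE; lra.
have A0 : d (f (- L)) (f 0) = L by rewrite fd subr0 normrN gtr0_norm.
have B0 : d (f L) (f 0) = L by rewrite fd subr0 gtr0_norm.
exists o; first by rewrite of_.
have rA : d (f (- L)) o = L + r by rewrite rE; lra.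
have rB : d o (f L) = L - r by rewrite of_.
move: Aop Bop; rewrite /between => Aop Bop.
have Lp : d p (f 0) = L - 1 by rewrite LE addrK.
have r1 : r < L by move: (mdist_tri (f (- L)) (f 0) p) => ?; mlra.
have r2 : - L < r by move: (mdist_tri (f L) (f 0) p) => ?; mlra.
move=> w; rewrite -fA => -[u _ <-{w}].
have ou : d o (f u) = `|r - u| by rewrite of_ fd.
have uA : d (f (- L)) (f u) = `|u + L| by rewrite fd distrC opprK.
have uB : d (f L) (f u) = `|L - u| by rewrite fd.
move: (mdist_tri p o (f u)) => h1.
have [ru|ur] := leP r u.
  rewrite (ler0_norm (_ : r - u <= 0)) ?subr_le0// in ou.
  have [uL|Lu] := leP u L.
    rewrite ger0_norm ?subr_ge0// in uB.
    by move: (mdist_tri p (f u) (f L)) => h2; mlra.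
  rewrite ltr0_norm ?subr_lt0// in uB.
  by case: (h4 p (f L) o (f u)) => h2; mlra.
rewrite (gtr0_norm (_ : 0 < r - u)) ?subr_gt0// in ou.
have [uL|Lu] := leP (- L) u.
  rewrite ger0_norm in uA; last lra.
  by move: (mdist_tri p (f u) (f (- L))) => h2; mlra.
rewrite ltr0_norm in uA; last lra.
by case: (h4 p (f (- L)) o (f u)) => h2; mlra.
Qed.

End Projection.

(** * Irreducible actions: cancellation at a base point and integral displacements *)

Section IrreducibleActions.
Context {R : realType} {G : groupType} {X : metricType R} (sigma : G -> X -> X).
Context (h4 : four_point X 0) (hj : forall x y : X, joined x y).
Arguments hj : clear implicits.
Context (sigmaA : isometric_action sigma).
Implicit Types (x y z u v w m o p q : X) (g h k : G).
Local Notation d := (@mdist R X).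
Local Notation t g := (translation_length (sigma g)).
Local Notation act1 := (act1 sigmaA).
Local Notation actM := (actM sigmaA).
Local Notation actd := (actd sigmaA).
Local Notation actdV := (actdV sigmaA).
Local Notation actdVr := (actdVr sigmaA).

(* [perp o x y]: the Gromov product of x and y based at o vanishes. *)
Definition perp o x y := d x y = d o x + d o y.

Lemma perp_sym o x y : perp o x y -> perp o y x.
Proof. by rewrite /perp mdistC addrC. Qed.

(** The second hypothesis says that [x] and [x'] leave [o] in a common direction, and orthogonality
    depends only on directions. *)
Lemma perp_trans o x x' y : perp o x y -> d x x' < d o x + d o x' -> perp o x' y.
Proof.
rewrite /perp => xy xx'; move: (mdist_tri x' o y) => ?.
by case: (h4 x y o x') => h; mlra.
Qed.

(** The point [z] cannot share its initial direction at [o] with both of two points in different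
    directions. *)
Lemma perp_or o x y z : perp o x y -> perp o z x \/ perp o z y.
Proof.
rewrite /perp => xy; move: (mdist_tri z o x) (mdist_tri z o y) => ? ?.
by case: (h4 x y o z) => h; [right|left]; mlra.
Qed.

(** The segments towards [g o] and [g^-1 o] do not overlap, so [d o (g^2 o)] is twice
    [d o (g o)]. *)
Lemma translation_length_perp o g : perp o (sigma g o) (sigma g^-1%g o) ->
  t g = d o (sigma g o).
Proof.
rewrite /perp actdVr => h; apply: translation_lengthE => //.
have e : d o (sigma g^-1%g o) = d o (sigma g o) by rewrite actdVr mdistC.
by rewrite e in h; move: h => h; mlra.
Qed.

(** There is no cancellation at [o] in [g h] nor in [h g], so [o] lies on the axis of [g h]. *)
Lemma translation_length_mul2 o g h : 0 < d o (sigma g o) -> 0 < d o (sigma h o) ->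
  perp o (sigma g^-1%g o) (sigma h o) -> perp o (sigma g o) (sigma h^-1%g o) ->
  t (g * h)%g = d o (sigma g o) + d o (sigma h o).
Proof.
move=> g0 h0 gh gh'.
have gV : d o (sigma g^-1%g o) = d o (sigma g o) by rewrite actdVr mdistC.
have hV : d o (sigma h^-1%g o) = d o (sigma h o) by rewrite actdVr mdistC.
have E : d o (sigma (g * h)%g o) = d o (sigma g o) + d o (sigma h o).
  by rewrite actM -actdV gh gV.
have EV : d o (sigma (g * h)^-1%g o) = d o (sigma g o) + d o (sigma h o).
  by rewrite actdVr mdistC.
rewrite (@translation_length_perp o)//.
have s1 : perp o (sigma (g * h)%g o) (sigma h^-1%g o).
  by apply: (perp_trans gh'); rewrite E actM actd; lra.
apply/perp_sym; move/perp_sym: s1 => /perp_trans; apply.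
by rewrite EV invgM actM actd gV hV; lra.
Qed.

Lemma translation_length_mul3 o g k h : 0 < d o (sigma g o) ->
  0 < d o (sigma k o) -> 0 < d o (sigma h o) ->
  perp o (sigma g^-1%g o) (sigma k o) -> perp o (sigma k^-1%g o) (sigma h o) ->
  perp o (sigma g o) (sigma h^-1%g o) ->
  t (g * k * h)%g = d o (sigma g o) + d o (sigma k o) + d o (sigma h o).
Proof.
move=> g0 k0 h0 gk kh gh.
have gV : d o (sigma g^-1%g o) = d o (sigma g o) by rewrite actdVr mdistC.
have hV : d o (sigma h^-1%g o) = d o (sigma h o) by rewrite actdVr mdistC.
have kV : d o (sigma k^-1%g o) = d o (sigma k o) by rewrite actdVr mdistC.
have e1 : d o (sigma (g * k)%g o) = d o (sigma g o) + d o (sigma k o).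
  by rewrite actM -actdV gk gV.
have e2 : d o (sigma (k * h)%g o) = d o (sigma k o) + d o (sigma h o).
  by rewrite actM -actdV kh kV.
have gkV : d o (sigma (g * k)^-1%g o) = d o (sigma g o) + d o (sigma k o).
  by rewrite actdVr mdistC.
have s1 : perp o (sigma (g * k)^-1%g o) (sigma h o).
  by apply: (perp_trans kh); rewrite gkV invgM actM actd gV kV; lra.
have s2 : perp o (sigma (g * k)%g o) (sigma h^-1%g o).
  by apply: (perp_trans gh); rewrite e1 actM actd; lra.
by rewrite (translation_length_mul2 _ h0 s1 s2) e1//; lra.
Qed.

(* [o] is the endpoint on the axis of [h] of the bridge between the axes of [g] and [h]. *)
Lemma irreducible_base : irreducible sigma ->
  exists o g h, [/\ 0 < d o (sigma g o), 0 < d o (sigma h o),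
    perp o (sigma h o) (sigma h^-1%g o) &
    forall g' h', g' = g \/ g' = g^-1%g -> h' = h \/ h' = h^-1%g ->
      perp o (sigma g' o) (sigma h' o)].
Proof.
move=> [g [h [[tg lg] [th lh] disj]]].
have [p pg] : exists p, characteristic_set (sigma g) p.
  by have [f [_ <-]] := lg; exists (f 0), 0.
have [ o oh po] := line_projection h4 hj p lh.
have [p' p'g op'] := line_projection h4 hj o lg.
have charV k x : characteristic_set (sigma k) x ->
    forall k', k' = k \/ k' = k^-1%g ->
    characteristic_set (sigma k) (sigma k' x) /\ d x (sigma k' x) = t k.
  rewrite /characteristic_set/= => xk k' [->|->].
    by rewrite actd.
  by split; [rewrite actdV (actVK sigmaA)|rewrite actdVr mdistC].
have o'g : 0 < d o p'.
  rewrite lt_neqAle mdist_ge0 andbT eq_sym; apply/eqP => /mdist_positivity E.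
  by have : set0 o; rewrite // -disj; split=> //; rewrite E.
(* The segment from [o] to [g' o] follows the bridge to [p'], then the axis of [g], and returns
   along the translate of the bridge by [g']. *)
have dgo g' : g' = g \/ g' = g^-1%g -> d o (sigma g' o) = 2 * d o p' + t g /\
    d (sigma g' o) p' = d o p' + t g.
  move=> hg'; have [c1 c2] := charV _ _ p'g _ hg'.
  have e1 := op' _ c1; have e2 := actd g' o p'.
  have e3 : d (sigma g' o) p' = d o p' + t g.
    have [c3 c4] : characteristic_set (sigma g) (sigma g'^-1%g p') /\
        d p' (sigma g'^-1%g p') = t g.
      by apply: charV => //; case: hg' => ->; [right|left; rewrite invgK].
    by rewrite -actdVr op'// c4.
  split=> //; move: (mdist_tri o p' (sigma g' o)) => ?.
  by case: (h4 o (sigma g' p') (sigma g' o) p') => h'; mlra.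
have ohd h' : h' = h \/ h' = h^-1%g -> d o (sigma h' o) = t h /\
    d p (sigma h' o) = d p o + t h.
  by move=> hh'; have [c1 c2] := charV _ _ oh _ hh'; rewrite po// c2.
exists o, g, h; split.
- by have [|-> _] := dgo g; [left|lra].
- by have [|-> _] := ohd h; [left|].
- have [_ e1] := charV _ _ oh h (or_introl erefl).
  have [_ e2] := charV _ _ oh _ (or_intror erefl).
  have E := translation_length_gt0 h4 hj sigmaA o th.
  by rewrite /perp e2 actdVr (mdistC _ o) E e1.
- move=> g' h' hg' hh'.
  have [e1 e2] := dgo _ hg'; have [e3 e4] := ohd _ hh'.
  have e5 := op' _ pg.
  have e6 : perp o p' (sigma h' o).
    by apply: (@perp_trans _ p); rewrite /perp; move: e3 e4 e5 o'g => *; mlra.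
  by apply: (perp_trans e6); mlra.
Qed.

(** The directions of [h o], [h^-1 o] and [g^-1 o] are pairwise orthogonal, so [p] shares at most
    one of them. Two free ones are the directions of [a^-1 o] and [b^-1 o]; then [a p] and [b p]
    leave [o] towards [a o] and [b o], which are orthogonal. *)
Lemma base_in_hull o g h p : 0 < d o (sigma g o) -> 0 < d o (sigma h o) ->
  perp o (sigma h o) (sigma h^-1%g o) ->
  (forall g' h', g' = g \/ g' = g^-1%g -> h' = h \/ h' = h^-1%g ->
      perp o (sigma g' o) (sigma h' o)) ->
  exists a b, between (sigma a p) o (sigma b p).
Proof.
move=> g0 h0 hh gh.
have lV k : d o (sigma k^-1%g o) = d o (sigma k o) by rewrite actdVr mdistC.
have key a b : 0 < d o (sigma a o) -> 0 < d o (sigma b o) ->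
    perp o p (sigma a^-1%g o) -> perp o p (sigma b^-1%g o) ->
    perp o (sigma a o) (sigma b o) -> exists a b, between (sigma a p) o (sigma b p).
  move=> a0 b0; rewrite /perp !lV => pa pb ab; exists a, b.
  have pull c : 0 < d o (sigma c o) -> d p (sigma c^-1%g o) = d o p + d o (sigma c o) ->
      d (sigma c o) (sigma c p) < d o (sigma c o) + d o (sigma c p).
    move=> c0 pc; rewrite actd -[d o (sigma c p)]actdV mdistC (mdistC (sigma _ _)) pc.
    by move: (mdist_ge0 o p) => *; mlra.
  have : perp o (sigma a p) (sigma b p).
    apply: (perp_trans _ (pull _ a0 pa)); apply/perp_sym.
    by apply: (perp_trans _ (pull _ b0 pb)); apply/perp_sym.
  by rewrite /perp /between => *; mlra.
have h'0 : 0 < d o (sigma h^-1%g o) by rewrite lV.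
have [h1|h1] := perp_or p hh;
  have [h2|h2] := perp_or p (gh g^-1%g h (or_intror erefl) (or_introl erefl));
  have [h3|h3] := perp_or p (gh g^-1%g h^-1%g (or_intror erefl) (or_intror erefl)).
all: first [ apply: (key g h) => //; apply: gh; by [left|right]
  | apply: (key g h^-1%g) => //; [by rewrite invgK|apply: gh; by [left|right]]
  | apply: (key h h^-1%g) => //; by rewrite invgK ].
Qed.

(* As at most one of the orthogonal directions [h o], [h^-1 o] and [g o] is blocked by
   [k o], and at most one by [k^-1 o], there are [a] and [b] among [g], [h] and [h^-1] such
   that [a k b] is cyclically reduced; its translation length is then
   [d o (a o) + d o (k o) + d o (b o)]. *)
Lemma displacement_int o g h k : 0 < d o (sigma g o) -> 0 < d o (sigma h o) ->
  perp o (sigma h o) (sigma h^-1%g o) ->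
  (forall g' h', g' = g \/ g' = g^-1%g -> h' = h \/ h' = h^-1%g ->
      perp o (sigma g' o) (sigma h' o)) ->
  (forall k, t k \is a Num.int) -> d o (sigma k o) \is a Num.int.
Proof.
move=> g0 h0 hh gh tint.
have lV a : d o (sigma a^-1%g o) = d o (sigma a o) by rewrite actdVr mdistC.
(* The base displacements come first: that of [h] is its translation length, and that of [g] is
   obtained from the product [g h]. *)
have hint : d o (sigma h o) \is a Num.int by rewrite -translation_length_perp.
have gint : d o (sigma g o) \is a Num.int.
  rewrite -(rpredDr _ hint) -(translation_length_mul2 g0 h0)//.
    by apply: gh; [right|left].
  by apply: gh; [left|right].
have [->|kn0] := eqVneq (d o (sigma k o)) 0; first exact: rpred0.
have k0 : 0 < d o (sigma k o) by rewrite lt_neqAle eq_sym kn0 mdist_ge0.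
have h'0 : 0 < d o (sigma h^-1%g o) by rewrite lV.
have h'int : d o (sigma h^-1%g o) \is a Num.int by rewrite lV.
have key a b : 0 < d o (sigma a o) -> 0 < d o (sigma b o) ->
    d o (sigma a o) \is a Num.int -> d o (sigma b o) \is a Num.int ->
    perp o (sigma a^-1%g o) (sigma k o) -> perp o (sigma k^-1%g o) (sigma b o) ->
    perp o (sigma a o) (sigma b^-1%g o) -> d o (sigma k o) \is a Num.int.
  move=> a0 b0 ai bi ak kb ab.
  have := tint (a * k * b)%g; rewrite (translation_length_mul3 a0 k0 b0 ak kb ab).
  by rewrite rpredDr// rpredDl.
have L1 : g = g \/ g = g^-1%g by left.
have L2 : g^-1%g = g \/ g^-1%g = g^-1%g by right.
have L3 : h = h \/ h = h^-1%g by left.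
have L4 : h^-1%g = h \/ h^-1%g = h^-1%g by right.
have hh' := perp_sym hh.
have := perp_or (sigma k o) hh; have := perp_or (sigma k o) (gh _ _ L2 L3).
have := perp_or (sigma k o) (gh _ _ L2 L4).
have := perp_or (sigma k^-1%g o) hh; have := perp_or (sigma k^-1%g o) (gh _ _ L1 L3).
have := perp_or (sigma k^-1%g o) (gh _ _ L1 L4).
have p1 := gh _ _ L1 L3; have p2 := gh _ _ L1 L4; have p3 := perp_sym (gh _ _ L2 L3).
have p4 := perp_sym (gh _ _ L2 L4).
move=> [q1|q1] [q2|q2] [q3|q3] [q4|q4] [q5|q5] [q6|q6];
  try (by apply: (key h h) => //; exact: perp_sym);
  try (by apply: (key h g) => //; exact: perp_sym);
  try (by apply: (key h^-1%g h^-1%g); rewrite ?invgK//; exact: perp_sym);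
  try (by apply: (key h^-1%g g); rewrite ?invgK//; exact: perp_sym);
  try (by apply: (key g h) => //; exact: perp_sym);
  try (by apply: (key g h^-1%g); rewrite ?invgK//; exact: perp_sym).
Qed.

End IrreducibleActions.

(** * Gaps between integers *)

Section Integers.
Context {R : realType}.
Implicit Types z : R.

Lemma int_gt0_ge1 z : z \is a Num.int -> 0 < z -> 1 <= z.
Proof.
move=> zi z0; have := norm_intr_ge1 zi; rewrite gtr0_norm//; apply.
by rewrite gt_eqF.
Qed.

Lemma int_lt1_eq0 z : z \is a Num.int -> -1 < z -> z < 1 -> z = 0.
Proof.
move=> zi z1 z2; apply/eqP; apply: contraT => /(norm_intr_ge1 zi).
by rewrite leNgt ltr_norml z1 z2.
Qed.

End Integers.

(** * The hull of an orbit: minimality and simplicial structure *)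

Section SimplicialHull.
Context {R : realType} {G : groupType} {X : metricType R} (sigma : G -> X -> X).
Context (h4 : four_point X 0) (hj : forall x y : X, joined x y).
Arguments hj : clear implicits.
Context (sigmaA : isometric_action sigma).
Context (o : X).
Implicit Types (x y z u v w p q : X) (g h k : G).
Local Notation d := (@mdist R X).
Local Notation act1 := (act1 sigmaA).
Local Notation actM := (actM sigmaA).
Local Notation actd := (actd sigmaA).
Local Notation actdV := (actdV sigmaA).
Local Notation actdVr := (actdVr sigmaA).

Definition hull : set X := [set p | exists g, between o p (sigma g o)].

Lemma hull_base : hull o.
Proof. by exists 1%g; exact: betweenL. Qed.

(** By [between_case] the point [z] lies on the way from [o] to [x] or to [y], hence on the segment
    from [o] to an orbit point. *)
Lemma hull_convex x y z : hull x -> hull y -> between x z y -> hull z.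
Proof.
move=> [g gx] [h hy] xzy; have [xz|yz] := between_case h4 o xzy; [exists g|exists h].
- move: gx xz; rewrite /between => *.
  by move: (mdist_tri o z (sigma g o)) (mdist_tri z x (sigma g o)) => *; mlra.
- move: hy yz; rewrite /between => *.
  by move: (mdist_tri o z (sigma h o)) (mdist_tri z y (sigma h o)) => *; mlra.
Qed.

Lemma hull_orbit g : hull (sigma g o).
Proof. by exists g; exact: betweenR. Qed.

Lemma hull_invariant : invariant_set sigma hull.
Proof.
move=> g x [h hx]; apply: (hull_convex (hull_orbit g) (hull_orbit (g * h)%g)).
by move: hx; rewrite actM /between !actd.
Qed.

Lemma hull_tree : R_tree (set_type hull).
Proof. by apply: subtree_of_convex => //; exact: hull_convex. Qed.

(** The hypothesis puts [o] between two points of any invariant subtree, which therefore contains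
    the orbit of [o] and the segments to it. *)
Lemma hull_sub (T : set X) :
  (forall p, exists a b, between (sigma a p) o (sigma b p)) ->
  subtree T -> invariant_set sigma T -> hull `<=` T.
Proof.
move=> base [[p Tp] tT] iT; have [a [b ab]] := base p.
have To : T o by apply: (subtree_between h4 tT _ _ ab); exact: iT.
by move=> x [g gx]; apply: (subtree_between h4 tT _ _ gx) => //; exact: iT.
Qed.

Definition hull_act g (y : set_type hull) : set_type hull :=
  SigSub (mem_set (hull_invariant g (set_valP y))).

Lemma hull_act_isometric : isometric_action hull_act.
Proof.
split=> [y|g h y|g y z].
- by apply: val_inj; exact: act1.
- by apply: val_inj; exact: actM.
- exact: actd.
Qed.

Lemma hull_four_point : four_point (set_type hull) 0.
Proof. by move=> x y z w; exact: h4. Qed.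

Lemma hull_joined (x y : set_type hull) : joined x y.
Proof.
move=> t tin; have [z [zt xzy]] := hj (set_val x) (set_val y) t tin.
by exists (SigSub (mem_set (hull_convex (set_valP x) (set_valP y) xzy))).
Qed.

(** Both lengths are given by one formula in the distances between [o], [g o] and [g^2 o], all of
    which lie in the hull. *)
Lemma hull_length_function : length_function hull_act = length_function sigma.
Proof.
apply/funext => g; pose o' : set_type hull := SigSub (mem_set hull_base).
rewrite /length_function (translation_length_act h4 hj sigmaA g o).
exact: (translation_length_act hull_four_point hull_joined hull_act_isometric g o').
Qed.

Section Vertices.
Context (oint : forall k, d o (sigma k o) \is a Num.int).

(** Half-integers are needed because branch points sit at Gromov products of orbit points, which are
    halves of integers. *)
Definition hull_vertex : set X := [set p | hull p /\ 2 * d o p \is a Num.int].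

Local Notation V := hull_vertex.
Local Notation int := (Num.int).

Lemma orbit_int g h : d (sigma g o) (sigma h o) \is a int.
Proof. by rewrite -actdVr -actM; exact: oint. Qed.

(** A closed walk in a tree has an even number of edges, here of length [1 / 2], so perimeters are
    integers. The three cases describe the positions of [p] and [q] relative to the segments from
    [o] to [g o] and [h o]. *)
Lemma vertex_perimeter0 p q : V p -> V q -> d o p + d o q + d p q \is a int.
Proof.
move=> [[g gp] pi] [[h hq] qi].
have : d o p + d o q + d p q = 2 * d o q \/ d o p + d o q + d p q = 2 * d o p \/
    d o p + d o q + d p q = d (sigma h o) (sigma g o) - d o (sigma h o)
      - d o (sigma g o) + 2 * d o q + 2 * d o p.
  move: (gp) (hq); rewrite /between => gp' hq'.
  have [|] := between_case h4 q gp; rewrite /between => h1; first by left; mlra.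
  have [|] := between_case h4 (sigma g o) hq; rewrite /between => h2; right.
    by left; mlra.
  by right; mlra.
have hg := orbit_int h g; move=> [->|[->|->]] //.
by rewrite !rpredD// ?rpredN//.
Qed.

Lemma vertex_perimeter p q r : V p -> V q -> V r -> d p q + d q r + d p r \is a int.
Proof.
move=> Vp Vq Vr.
have -> : d p q + d q r + d p r = (d o p + d o q + d p q) + (d o q + d o r + d q r)
    + (d o p + d o r + d p r) - 2 * d o p - 2 * d o q - 2 * d o r by lra.
have [_ ip] := Vp; have [_ iq] := Vq; have [_ ir] := Vr.
do 3!apply: rpredB => //.
by apply: rpredD; [apply: rpredD|]; exact: vertex_perimeter0.
Qed.

Lemma vertex_dist p q : V p -> V q -> 2 * d p q \is a int.
Proof.
move=> Vp Vq; have := vertex_perimeter Vp Vq Vp.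
by rewrite mdist0 addr0 (mdistC q p) mulr_natl mulr2n.
Qed.

Lemma vertex_dist_ge p q : V p -> V q -> p <> q -> 1 / 2 <= d p q.
Proof.
move=> Vp Vq pq; have : 0 < 2 * d p q.
  rewrite mulr_gt0// lt_neqAle mdist_ge0 andbT eq_sym.
  by apply/eqP => /mdist_positivity.
by move=> /(int_gt0_ge1 (vertex_dist Vp Vq)); lra.
Qed.

Lemma vertex_between u v x : V u -> V v -> between u x v -> 2 * d u x \is a int -> V x.
Proof.
move=> Vu Vv uxv ix; split; first by case: Vu Vv => ? _ [? _]; exact: hull_convex uxv.
have iuv := vertex_dist Vu Vv; have [_ iu] := Vu; have [_ iv] := Vv.
have : 2 * d o x = 2 * d o u - 2 * d u x \/
    2 * d o x = 2 * d o v - (2 * d u v - 2 * d u x).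
  by move: (uxv) (between_case h4 o uxv); rewrite /between => ? [?|?]; [left|right]; mlra.
by move=> [->|->]; rewrite !rpredB.
Qed.

Lemma vertex_act g p : V p -> V (sigma g p).
Proof.
move=> [[h hp] ip]; have gp : between (sigma g o) (sigma g p) (sigma (g * h)%g o).
  by move: hp; rewrite actM /between !actd.
have Vorb k : V (sigma k o).
  by split; [exact: hull_orbit|rewrite mulr_natl rpredMn].
by apply: (vertex_between (Vorb g) (Vorb _) gp); rewrite actd.
Qed.

(** The distances of [u] and [v] from [o] are [d o x] rounded down and up to half-integers; a vertex
    is treated as a degenerate edge. *)
Lemma hull_edge x : hull x -> exists u v,
  [/\ V u, V v, u = v \/ d u v = 1 / 2 & between u x v].
Proof.
move=> [g gx]; set n := d o (sigma g o) in gx.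
have hx : hull x by exists g.
set r := d o x; pose k : R := (Num.floor (2 * r))%:~R.
have k_int : k \is a int by exact: intr_int.
have kr : k <= 2 * r by exact: floor_le_tmp.
have rk : 2 * r < k + 1 by rewrite /k -[1]/(1%:~R) -intrD floorD1_gt.
have [E|kn] := eqVneq k (2 * r).
  by exists x, x; split; [split=> //; rewrite -E|split=> //; rewrite -E|left|exact: betweenL].
have kr' : k < 2 * r by rewrite lt_neqAle kn.
have r0 : 0 <= r := mdist_ge0 _ _.
have k0 : 0 <= k.
  by rewrite /k ler0z -floor_ge0 in r0 *; rewrite floor_ge0 mulr_ge0// -floor_ge0.
have rn : r <= n by move: gx; rewrite /between -/n -/r => ?; mlra.
have n_int : n \is a int by exact: oint.
(* As [2 * n] is an integer greater than [k], the upper vertex still lies on the segment from [o] to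
   [g o]. *)
have kn2 : k + 1 <= 2 * n.
  suff : 1 <= 2 * n - k by lra.
  apply: int_gt0_ge1; last lra.
  by rewrite rpredB// mulr_natl rpredMn.
have [|u [uk ou]] := hj o x (k / 2); first by rewrite -/r; apply/andP; split; lra.
move: gx; rewrite /between -/n -/r => gx.
have [|v [vk xv]] := hj x (sigma g o) ((k + 1) / 2 - r).
  by apply/andP; split; lra.
move: ou xv; rewrite /between -/r => ou xv.
have ov : d o v = (k + 1) / 2.
  move: (mdist_tri o x v) (mdist_tri o v (sigma g o)); rewrite -/r -/n => *; mlra.
have hu : hull u.
  exists g; move: (mdist_tri o u (sigma g o)) (mdist_tri u x (sigma g o)).
  by rewrite /between -/n => *; mlra.
have hv : hull v.
  by exists g; move: (mdist_tri o v (sigma g o)); rewrite /between -/n => *; mlra.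
have uv : d u v = 1 / 2.
  by move: (mdist_tri u x v) (mdist_tri o u v) => *; mlra.
exists u, v; split.
- by split=> //; rewrite uk mulrC divfK// pnatr_eq0.
- by split=> //; rewrite ov mulrC divfK ?pnatr_eq0// rpredD// rpred1.
- by right.
- by rewrite /between uv; mlra.
Qed.

Definition hull_adj : rel (set_type V) :=
  fun u v : set_type V => d (set_val u) (set_val v) == 1 / 2.

Lemma hull_graph_tree : graph_tree hull_adj.
Proof.
have Vo : V o by split; [exact: hull_base|rewrite mdist0 mulr0 rpred0].
split.
- exact: (inhabits (SigSub (mem_set Vo))).
- by move=> u v; rewrite /hull_adj mdistC.
- by move=> u; rewrite /hull_adj mdist0; apply/eqP; lra.
- move=> u v; have := vertex_dist (set_valP u) (set_valP v).
  have ge0 : 0 <= 2 * d (set_val u) (set_val v) by rewrite mulr_ge0 ?mdist_ge0.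
  move=> i; have : 2 * d (set_val u) (set_val v) \is a Num.nat by rewrite natrEint i ge0.
  move=> /natrP[n]; elim: n u {ge0 i} => [|n ih] u.
    move=> uv; exists [::]; split=> //=; apply: val_inj.
    by apply: (@mdist_le0_eq _ _ (set_val u) (set_val v)); lra.
  rewrite -natr1 => uv; have n0 : 0 <= n%:R :> R by exact: ler0n.
  have [|x [xu b]] := hj (set_val u) (set_val v) (1 / 2); first by apply/andP; split; lra.
  have Vx : V x.
    apply: (vertex_between _ _ b); [exact: set_valP|exact: set_valP|].
    by rewrite xu mulrC divfK ?pnatr_eq0// rpred1.
  pose x' : set_type V := SigSub (mem_set Vx).
  have [|p [xp pl]] := ih x'.
    by move: b; rewrite /between /= => b; lra.
  by exists (x' :: p); split=> //=; rewrite xp andbT /hull_adj xu.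
- move=> c uc; rewrite ltnNge; apply/negP => c3.
  (* In a cycle, consider a vertex [v] farthest from [o]: its two neighbours turn out to be the same
     point of the segment from [o] to [v]. *)
  have [|v vc vmax] := exists_max_seq (fun p : set_type V => d o (set_val p)) (r := c).
    by case: c c3 {uc}.
  have [i s sE] := rot_to vc.
  have : (2 < size (v :: s))%N by rewrite -sE size_rot.
  have : ucycle hull_adj (v :: s) by rewrite -sE rot_ucycle.
  have smax (p : set_type V) : p \in s -> d o (set_val p) <= d o (set_val v).
    by move=> ps; apply: vmax; rewrite -(mem_rot i) sE inE ps orbT.
  case/lastP: s smax {sE} => [//|[//|w s] u] smax.
  rewrite /ucycle /= !rcons_path last_rcons => /andP[/and3P[vw _ uv]] /andP[_ /andP[+ _]] _.
  rewrite mem_rcons inE negb_or => /andP[/eqP wu _]; apply: wu.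
  (* A neighbour [p] is no farther from [o] than [v], and integrality of the perimeter excludes
     every distance but [d o v - 1 / 2]. *)
  have key (p : set_type V) : p \in rcons (w :: s) u -> hull_adj v p ->
      between o (set_val p) (set_val v) /\ d o (set_val p) = d o (set_val v) - 1 / 2.
    move=> /smax pv /eqP vp.
    have : d o (set_val v) + d o (set_val p) + d (set_val v) (set_val p)
        - 2 * d o (set_val v) \is a int.
      by rewrite rpredB ?vertex_perimeter0//; [exact: set_valP|exact: set_valP|case: (set_valP v)].
    move: (mdist_tri o (set_val p) (set_val v)) => tr.
    have tr' : d o (set_val v) <= d o (set_val p) + 1 / 2 by rewrite -vp; mlra.
    move=> /int_lt1_eq0 -/(_ _ _)-z; rewrite /between.
    have {z} : d o (set_val v) + d o (set_val p) + d (set_val v) (set_val p)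
        - 2 * d o (set_val v) = 0 by apply: z; lra.
    by move=> z; split; [rewrite (mdistC (set_val p)) vp; lra|lra].
  have [bw ew] := key w ltac:(by rewrite mem_rcons !inE eqxx orbT) vw.
  have [|bu eu] := key u ltac:(by rewrite mem_rcons !inE eqxx).
    by rewrite /hull_adj mdistC.
  by apply: val_inj; apply: (between_inj h4 bw bu); rewrite ew eu.
Qed.

(* Edges have length 1/2, so the barycentric coordinate of [x] at a vertex [w] is
   [1 - 2 d(w, x)] as long as [x] is within 1/2 of [w], and 0 beyond. *)
Definition hull_coord x : set_type V -> R :=
  fun w : set_type V => Num.max 0 (1 - 2 * d (set_val w) x).

Lemma hull_coord_edge (u v : set_type V) (t : R) x : hull_adj u v -> t \in `[0, 1] ->
  d (set_val u) x = t / 2 -> between (set_val u) x (set_val v) ->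
  hull_coord x = bary u v t.
Proof.
move=> /eqP uv; rewrite in_itv/= => /andP[t0 t1] ux.
rewrite /between ux uv => xv; apply/funext => w; rewrite /hull_coord /bary.
have vu : (v == u) = false.
  by apply/negbTE/eqP => vu; move: uv; rewrite vu mdist0; lra.
have [->|wu] := eqVneq w u.
  by rewrite ux eq_sym vu mulr1 mulr0 addr0 max_r; lra.
have [->|wv] := eqVneq w v.
  by rewrite mdistC mulr0 mulr1 add0r max_r; lra.
rewrite !mulr0 addr0 max_l//.
have gt (u' : set_type V) : w != u' -> 1 / 2 <= d (set_val w) (set_val u').
  move=> wu'; apply: vertex_dist_ge; [exact: set_valP|exact: set_valP|].
  by move=> /val_inj /eqP; apply/negP.
have := gt _ wu; have := gt _ wv => gv gu.
have i1 := vertex_dist (set_valP w) (set_valP u).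
have i2 := vertex_perimeter (set_valP u) (set_valP v) (set_valP w).
have [le|lt] := leP 1 (d (set_val w) (set_val u)).
  by move: (mdist_tri (set_val w) x (set_val u)) => ?; mlra.
have wu2 : d (set_val w) (set_val u) = 1 / 2.
  suff : 2 * d (set_val w) (set_val u) - 1 = 0 by lra.
  by apply: int_lt1_eq0; rewrite ?rpredB ?rpred1//; lra.
(* The perimeter of [u], [v], [w] is an integer and two of its sides are [1 / 2], so the third is a
   positive integer. *)
have wv1 : 1 <= d (set_val w) (set_val v).
  move: i2; rewrite uv (mdistC (set_val u)) wu2 (mdistC (set_val v)) => i2.
  have : 1 <= 1 / 2 + d (set_val w) (set_val v) + 1 / 2 - 1.
    by apply: int_gt0_ge1; [rewrite rpredB// rpred1|lra].
  by lra.
by move: (mdist_tri (set_val w) x (set_val v)) => ?; mlra.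
Qed.

Lemma hull_coord_vertex (u : set_type V) : hull_coord (set_val u) = bary u u 0.
Proof.
apply/funext => w; rewrite /hull_coord /bary mul0r addr0 subr0 mul1r.
have [->|wu] := eqVneq w u; first by rewrite mdist0 mulr0 subr0 max_r.
rewrite max_l//; have : 1 / 2 <= d (set_val w) (set_val u); last lra.
apply: vertex_dist_ge; [exact: set_valP|exact: set_valP|].
by move=> /val_inj /eqP; apply/negP.
Qed.

(** Coordinates record the distances to vertices nearer than [1 / 2]. On an edge of length [1 / 2]
    this determines [x]: a point at distance [1 / 2] from one end is the other end. *)
Lemma hull_coord_inj x y : hull x -> hull_coord x = hull_coord y -> x = y.
Proof.
move=> /hull_edge[u [v [Vu Vv uv uxv]]] xy.
have xyV (w : X) (Vw : V w) : d w x < 1 / 2 -> d w y = d w x.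
  move=> wx; have := congr1 (fun b => b (SigSub (mem_set Vw))) xy.
  rewrite /hull_coord /= max_r; last lra.
  by case: leP => h; lra.
have zero w : V w -> d w x = 0 -> x = y.
  move=> Vw wx; have := xyV w Vw; rewrite wx => wy.
  have {}wy : d w y = 0 by apply: wy; lra.
  by rewrite -(mdist_positivity _ _ wx) -(mdist_positivity _ _ wy).
case: uv => [uv|uv].
  by apply: (zero u) => //; move: uxv; rewrite /between -uv mdist0 => ?; mlra.
move: (uxv); rewrite /between uv => uxv'.
have [ux|/xyV-/(_ Vu) uy] := leP (1 / 2) (d u x).
  by apply: (zero v) => //; mlra.
have [vx|/xyV-/(_ Vv) vy] := leP (1 / 2) (d v x).
  by apply: (zero u) => //; mlra.
by apply: (between_inj h4 uxv) => //; rewrite /between uy uv; mlra.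
Qed.

Lemma hull_coord_surj (b : set_type V -> R) : realization_set hull_adj b ->
  exists x, hull x /\ hull_coord x = b.
Proof.
move=> [u [v [t [[<-|uv] t01 ->]]]].
  exists (set_val u); split; first by case: (set_valP u).
  rewrite hull_coord_vertex; apply/funext => w; rewrite /bary subr0 mul0r.
  by lra.
move: (uv) => /eqP uv2; move: (t01); rewrite in_itv/= => /andP[t0 t1].
have [|x [xt b']] := hj (set_val u) (set_val v) (t / 2).
  by rewrite uv2; apply/andP; split; lra.
exists x; split; last exact: hull_coord_edge.
by apply: (hull_convex _ _ b'); [case: (set_valP u)|case: (set_valP v)].
Qed.

Lemma hull_coord_realization x : hull x -> realization_set hull_adj (hull_coord x).
Proof.
move=> /hull_edge[u [v [Vu Vv uv uxv]]].
pose u' : set_type V := SigSub (mem_set Vu); pose v' : set_type V := SigSub (mem_set Vv).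
case: uv => uv.
  have -> : x = set_val u'.
    by apply: mdist_le0_eq; move: uxv; rewrite /between -uv mdist0 /= => ?; mlra.
  exists u', u', 0; split; [by left|by rewrite in_itv/= lexx ler01|].
  exact: hull_coord_vertex.
have uv' : hull_adj u' v' by exact/eqP.
have tin : 2 * d u x \in `[0, 1].
  by rewrite in_itv/=; move: uxv; rewrite /between uv => ?; apply/andP; split; mlra.
exists u', v', (2 * d u x); split=> //; first by right.
by apply: hull_coord_edge => //=; lra.
Qed.

(** The realization map [f] is the inverse of [hull_coord], chosen from its surjectivity. *)
Lemma hull_simplicial : simplicial_tree_action hull_act.
Proof.
split; [exact: hull_tree|exact: hull_act_isometric|].
have /choice[f fP] : forall b : realization R hull_adj, exists x : set_type hull,
    hull_coord (set_val x) = val b.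
  move=> b; have [x [hx xb]] := hull_coord_surj (set_valP b).
  by exists (SigSub (mem_set hx)).
have f_eq b (x : set_type hull) : hull_coord (set_val x) = val b -> f b = x.
  move=> xb; apply: val_inj; apply: hull_coord_inj; first exact: set_valP.
  by rewrite fP xb.
have Vhull (v : set_type V) : hull (set_val v) by case: (set_valP v).
have fvertex (v : set_type V) : f (vertex v) = SigSub (mem_set (Vhull v)).
  by apply: f_eq; exact: hull_coord_vertex.
exists (set_type V), hull_adj, f; split; last first.
  move=> g v; exists (SigSub (mem_set (vertex_act g (set_valP v)))).
  by rewrite !fvertex; exact: val_inj.
have fedge (u v : set_type V) : hull_adj u v -> mdist (f (vertex u)) (f (vertex v)) = 1 / 2.
  by move=> /eqP uv; rewrite !fvertex.
split.
- exact: hull_graph_tree.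
- exists (fun x : set_type hull =>
    SigSub (mem_set (hull_coord_realization (set_valP x))) : realization R hull_adj).
    by move=> b; apply: val_inj; exact: fP.
  by move=> x; exact: f_eq.
- move=> u v s t p q uv sin tin ps qt; rewrite fedge//.
  have point r (c : realization R hull_adj) : r \in `[0, 1] -> val c = bary u v r ->
      between (set_val u) (set_val (f c)) (set_val v) /\
      d (set_val u) (set_val (f c)) = r / 2.
    move=> rin cr; move: (uv) => /eqP uv2; move: (rin); rewrite in_itv/= => /andP[r0 r1].
    have [|x [xr b]] := hj (set_val u) (set_val v) (r / 2).
      by rewrite uv2; apply/andP; split; lra.
    have hx : hull x by exact: hull_convex b.
    have -> : f c = SigSub (mem_set hx) by apply: f_eq; rewrite cr; exact: hull_coord_edge.
    by [].
  have [bp dp] := point s p sin ps; have [bq dq] := point t q tin qt.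
  have -> : mdist (f p) (f q) = d (set_val (f p)) (set_val (f q)) by [].
  have : d (set_val (f p)) (set_val (f q)) = s / 2 - t / 2 /\ t <= s \/
      d (set_val (f p)) (set_val (f q)) = t / 2 - s / 2 /\ s <= t.
    move: (bp) (bq); rewrite /between => h1 h2.
    by have [] := between_case h4 (set_val (f q)) bp; rewrite /between => h; [right|left];
      split; mlra.
  by move=> [[-> ts]|[-> st]]; [rewrite ger0_norm|rewrite ler0_norm]; lra.
- by exists (1 / 2) => //; lra.
Qed.

End Vertices.

Lemma hull_minimal : (forall p, exists a b, between (sigma a p) o (sigma b p)) ->
  minimal_invariant_subtree sigma hull.
Proof.
move=> base; split.
- by split; [exists o; exact: hull_base|exact: hull_tree].
- exact: hull_invariant.
- by move=> T tT iT Th; apply/seteqP; split=> //; exact: hull_sub.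
Qed.

Lemma hull_unique (T : set X) :
  (forall p, exists a b, between (sigma a p) o (sigma b p)) ->
  minimal_invariant_subtree sigma T -> T = hull.
Proof.
move=> base [tT iT minT]; apply/esym/minT; last exact: hull_sub.
  by split; [exists o; exact: hull_base|exact: hull_tree].
exact: hull_invariant.
Qed.

End SimplicialHull.

(** The base point comes from [irreducible_base]; [base_in_hull] makes its hull minimal and
    [displacement_int] makes the hull simplicial. *)
Lemma irreducible_integral_simplicial (R : realType) (G : groupType) (X : metricType R)
    (sigma : G -> X -> X) :
  four_point X 0 -> (forall x y : X, joined x y) -> isometric_action sigma ->
  irreducible sigma -> (forall g, length_function sigma g \is a Num.int) ->
  exists T : set X,
    [/\ minimal_invariant_subtree sigma T,
        forall T', minimal_invariant_subtree sigma T' -> T' = T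
      & exists tau : G -> T -> T,
          [/\ forall g y, set_val (tau g y) = sigma g (set_val y),
              simplicial_tree_action tau
            & length_function tau = length_function sigma]].
Proof.
move=> h4 hj sA irr int_length.
have [ o [g [h [g0 h0 hh gh]]]] := irreducible_base h4 hj sA irr.
have base p := base_in_hull h4 sA p g0 h0 hh gh.
have oint k := displacement_int h4 hj sA k g0 h0 hh gh int_length.
exists (hull sigma o); split.
- exact: hull_minimal.
- by move=> T; exact: hull_unique.
- exists (hull_act h4 sA (o := o)); split=> //; first exact: hull_simplicial.
  exact: hull_length_function.
Qed.

(** * Extraction of a subsequence by an ultrafilter *)

Section Subsequences.
Context {R : realType}.

Lemma cvg_seq_unique (u : nat -> R) (a b : R) :
  u @ \oo --> a -> u @ \oo --> b -> a = b.
Proof. by move=> ua ub; apply: (cvg_unique _ ua ub). Qed.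

Lemma cvg_maxr (u v : nat -> R) (a b : R) : u @ \oo --> a -> v @ \oo --> b ->
  (fun n => Num.max (u n) (v n)) @ \oo --> Num.max a b.
Proof.
move=> ua vb; under eq_fun do rewrite maxr_absE; rewrite maxr_absE.
by apply: cvgMl; apply: cvgD; [exact: cvgD|apply: cvg_norm; exact: cvgB].
Qed.

(** Compactness of the interval gives a cluster point, and an ultrafilter converges to each of its
    cluster points. *)
Lemma ultra_bounded_cvg (U : set_system nat) (a : nat -> R) (C : R) :
  UltraFilter U -> (forall n, `|a n| <= C) -> exists L : R, a @ U --> L.
Proof.
move=> UU aC; have cpt := @segment_compact R (- C) C.
have [|L [_ clL]] := cpt (a @ U) _.
  by apply: (@filterS _ U _ setT) => [n _ /=|]; [rewrite in_itv/= -ler_norml|exact: filterT].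
exists L => B LB; have [//|nB] := in_ultra_setVsetC (a @^-1` B) UU.
have [y [/= nBy By]] := clL (~` B) B nB LB.
by [].
Qed.

(* The limits are taken along an ultrafilter, which avoids a diagonal argument. *)
Lemma extract_subsequence (T : Type) (enum : nat -> T) (a : nat -> T -> R)
    (C : T -> R) (N0 : nat) :
  (forall g, exists k, enum k = g) -> (forall n g, `|a n g| <= C g) ->
  exists phi : nat -> nat,
    [/\ {homo phi : m n / (m < n)%N}, forall n, (N0 <= phi n)%N &
      forall g, exists L : R, (fun n => a (phi n) g) @ \oo --> L].
Proof.
move=> enumP aC.
have [U [UU ooU]] := @ultraFilterLemma nat \oo _.
have /choice[L LP] : forall g, exists L : R, (fun n => a n g) @ U --> L.
  by move=> g; exact: (ultra_bounded_cvg UU (fun n => aC n g)).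
(* Finitely many sets of [U] meet, also with a tail: beyond any [N] some index is within
   [1 / (k + 1)] of the limits at the first [k + 1] elements. Iterating this choice defines
   [phi]. *)
have next k N : exists n, (N < n)%N /\
    forall i, (i <= k)%N -> `|a n (enum i) - L (enum i)| < k.+1%:R^-1.
  suff : U [set n | (N < n)%N /\
      forall i, (i < k.+1)%N -> `|a n (enum i) - L (enum i)| < k.+1%:R^-1].
    by move=> /filter_ex[n [Nn h]]; exists n; split.
  apply: filterI; first by apply: ooU; exists N.+1.
  suff H j : U [set n | forall i, (i < j)%N -> `|a n (enum i) - L (enum i)| < k.+1%:R^-1].
    exact: H.
  elim: j => [|j ih]; first by apply: filterS filterT.
  have := LP (enum j); move=> /cvgrPdist_lt /(_ k.+1%:R^-1).
  rewrite invr_gt0 ltr0n => /(_ isT) hj.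
  apply: filterS (filterI ih hj) => n [h1 h2] i.
  rewrite ltnS leq_eqVlt => /predU1P[->|/h1//].
  by rewrite distrC.
have /choice[f fP] : forall kN : nat * nat, exists n, (kN.2 < n)%N /\
    forall i, (i <= kN.1)%N -> `|a n (enum i) - L (enum i)| < kN.1.+1%:R^-1.
  by move=> [k N]; exact: next.
pose phi := fix phi k := if k is k'.+1 then f (k, phi k') else f (0%N, N0).
have phiS k : (phi k < phi k.+1)%N by have [] := fP (k.+1, phi k).
have phi_close k i : (i <= k)%N -> `|a (phi k) (enum i) - L (enum i)| < k.+1%:R^-1.
  by case: k => [|k] ik; [have [_] := fP (0%N, N0)|have [_] := fP (k.+1, phi k)]; apply.
exists phi; split.
- by apply: homo_ltn => //; exact: ltn_trans.
- elim=> [|n ih]; first by have [/ltnW] := fP (0%N, N0).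
  by rewrite (leq_trans ih)// ltnW.
- move=> g; have [i <-] := enumP g; exists (L (enum i)).
  apply/cvgrPdist_lt => e e0; near=> n.
  rewrite distrC (lt_trans (phi_close n i _))//; first by near: n; exact: nbhs_infty_ge.
  by near: n; exact: near_infty_natSinv_lt (PosNum e0).
Unshelve. all: by end_near. Qed.

End Subsequences.

(** * Countability of the group, and displacements bounded by those of the generators *)

Section FinitelyGenerated.
Context {G : groupType} (S : seq G).
Local Open Scope group_scope.

(** Words are encoded as binary trees, a countable type. Nodes are quotients because [group_closed]
    is closure under [1] and division. *)
Fixpoint tree_eval (w : GenTree.tree nat) : G :=
  match w with
  | GenTree.Leaf n => nth 1 S n
  | GenTree.Node _ (w1 :: w2 :: _) => tree_eval w1 / tree_eval w2
  | GenTree.Node _ _ => 1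
  end.

Lemma generated_countable : generates S -> exists enum : nat -> G,
  forall g, exists k, enum k = g.
Proof.
move=> gS; exists (fun n => tree_eval (odflt (GenTree.Leaf 0%N) (unpickle n))).
pose A : {pred G} := [pred g | `[< exists w, tree_eval w = g >]].
have AT : A =i predT.
  apply: gS.
    split; first by apply/asboolP; exists (GenTree.Node 0 [::]).
    move=> u v /asboolP[w1 <-] /asboolP[w2 <-]; apply/asboolP.
    by exists (GenTree.Node 0 [:: w1; w2]).
  move=> g gin; apply/asboolP; exists (GenTree.Leaf (index g S)).
  by rewrite /= nth_index.
move=> g; have : g \in A by rewrite AT.
move=> /asboolP[w <-]; exists (pickle w).
by rewrite pickleK.
Qed.

End FinitelyGenerated.

(** The elements admitting such a constant form a subgroup containing [S]. What matters is that [C]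
    is the same for all [n]. *)
Lemma displacement_bound (R : realType) (G : groupType) (S : seq G)
    (H : nat -> metricType R) (rho : forall n, G -> H n -> H n) (x : forall n, H n) :
  generates S -> (forall n, isometric_action (rho n)) ->
  forall g, exists2 C : R, 0 <= C & forall n,
    mdist (x n) (rho n g (x n)) <= C * displacement S (rho n) (x n).
Proof.
move=> gS rhoA; pose A : {pred G} := [pred g | `[< exists2 C : R, 0 <= C &
  forall n, mdist (x n) (rho n g (x n)) <= C * displacement S (rho n) (x n) >]].
suff AT : A =i predT.
  by move=> g; apply/asboolP; have : g \in A by rewrite AT.
apply: gS.
  split; first by apply/asboolP; exists 0 => // n; rewrite (act1 (rhoA n)) mdist0 mul0r.
  move=> u v /asboolP[C C0 uC] /asboolP[C' C'0 vC']; apply/asboolP.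
  exists (C + C'); first exact: addr_ge0.
  move=> n; rewrite (actM (rhoA n)) mulrDl.
  have := mdist_tri (x n) (rho n u (x n)) (rho n u (rho n v^-1%g (x n))).
  rewrite (actd (rhoA n)) (actdVr (rhoA n)) (mdistC (rho n v _)).
  by have := uC n; have := vC' n; lra.
move=> g gin; apply/asboolP; exists 1 => // n; rewrite mul1r.
exact: (@le_bigmax_seq _ _ _ _ 0 g xpredT).
Qed.

(** * Points of the complete graph and the action of the group on them *)

Section Realization.
Context {R : realType} {G : groupType}.
Local Notation K := (realization R (@complete_graph G)).
Implicit Types (p q : K) (u v : G) (t : R).

Lemma bary0 u v : bary u v (0 : R) = bary u u 0.
Proof. by apply/funext => w; rewrite /bary !mul0r. Qed.

Lemma bary1 u v : bary u v (1 : R) = bary v v 0.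
Proof. by apply/funext => w; rewrite /bary subrr mul0r mul1r mul0r subr0 mul1r addrC. Qed.

Lemma realization_cases p : (exists u, p = vertex u) \/
  exists u v t, [/\ u != v, 0 <= t <= 1 & val p = bary u v t].
Proof.
have [u [v [t [[<-|uv] t01 pE]]]] := set_valP p; [left|right].
  exists u; apply: val_inj; rewrite [LHS]pE; apply/funext => w.
  by rewrite /= /bary subr0 mul0r; lra.
by exists u, v, t; split=> //; rewrite in_itv/= in t01.
Qed.

Lemma edge_point u v t : u != v -> 0 <= t <= 1 -> exists p, val p = bary u v t.
Proof.
move=> uv t01; have h : realization_set (@complete_graph G) (bary u v t).
  by exists u, v, t; split; [right|rewrite in_itv|].
by exists (SigSub (mem_set h)).
Qed.

Lemma left_mul1 p : left_mul 1%g p = p.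
Proof. by apply: val_inj; apply/funext => h /=; rewrite invg1 mul1g. Qed.

Lemma left_mulM g h p : left_mul (g * h)%g p = left_mul g (left_mul h p).
Proof. by apply: val_inj; apply/funext => k /=; rewrite invgM mulgA. Qed.

Lemma left_mul_vertex g u : left_mul g (vertex u) = vertex (g * u)%g :> K.
Proof.
apply: val_inj; apply/funext => h; rewrite /= /bary.
suff -> : (g^-1 * h == u)%g = (h == g * u)%g by [].
by apply/eqP/eqP => [<-|->]; rewrite ?mulVKg ?mulKg.
Qed.

End Realization.

(** * Limits of pseudo-metrics [D n] on the graph that satisfy the four-point inequality up to
    [e n] *)

Section LimitPseudoMetric.
Context {R : realType} {G : groupType}.
Local Notation K := (realization R (@complete_graph G)).
Context (D : nat -> K -> K -> R) (e : nat -> R).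
Context (Dxx : forall n p, D n p p = 0).
Context (Dsym : forall n p q, D n p q = D n q p).
Context (Dtri : forall n q p r, D n p r <= D n p q + D n q r).
Context (D4 : forall n p q r s, D n p q + D n r s <=
  Num.max (D n p r + D n q s) (D n p s + D n q r) + e n).
Context (De : e @ \oo --> 0).
Context (Dstraight : forall n u v (s t : R) (p q : K), u != v -> s \in `[0, 1] -> t \in `[0, 1] ->
  val p = bary u v s -> val q = bary u v t ->
  D n p q = `|s - t| * D n (vertex u) (vertex v)).
Context (Dinv : forall n g p q, D n (left_mul g p) (left_mul g q) = D n p q).
Context (Dvertex : forall u v, exists L : R,
  (fun n => D n (vertex u) (vertex v)) @ \oo --> L).
Implicit Types (p q r : K) (u v w : G) (t : R).

Let Dedge n u v t p : u != v -> 0 <= t <= 1 -> val p = bary u v t ->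
  D n (vertex u) p = t * D n (vertex u) (vertex v) /\
  D n p (vertex v) = (1 - t) * D n (vertex u) (vertex v).
Proof.
move=> uv t01 pE; have /andP[t0 t1] := t01.
have i0 : (0 : R) \in `[0, 1] by rewrite in_itv/= lexx ler01.
have i1 : (1 : R) \in `[0, 1] by rewrite in_itv/= lexx ler01.
have it : t \in `[0, 1] by rewrite in_itv.
rewrite (Dstraight n uv i0 it _ pE); last by rewrite bary0.
rewrite (Dstraight n uv it i1 pE); last by rewrite bary1.
by rewrite sub0r normrN ger0_norm// distrC ger0_norm ?subr_ge0.
Qed.

(** On an edge, [D n p q] lies between the maximum [M n], by the triangle inequality, and
    [M n + e n], by the four-point inequality. The statement serves twice, once for each argument of
    [D n]. *)
Let Dcvg_from_vertices q : (forall w, exists L : R, (fun n => D n (vertex w) q) @ \oo --> L) ->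
  forall p, exists L : R, (fun n => D n p q) @ \oo --> L.
Proof.
move=> qL p; have [[u ->]|[u [v [t [uv t01 pE]]]]] := realization_cases p.
  exact: qL.
have [Lu uL] := qL u; have [Lv vL] := qL v; have [l uvl] := Dvertex u v.
exists (Num.max (Lu - t * l) (Lv - (1 - t) * l)).
pose M n := Num.max (D n (vertex u) q - t * D n (vertex u) (vertex v))
  (D n (vertex v) q - (1 - t) * D n (vertex u) (vertex v)).
have cM : M @ \oo --> Num.max (Lu - t * l) (Lv - (1 - t) * l).
  by apply: cvg_maxr; apply: cvgB => //; exact: cvgMr.
apply: (squeeze_cvgr _ cM (_ : (fun n => M n + e n) @ \oo --> _)); last first.
  by rewrite -[X in _ --> X]addr0; exact: cvgD.
near=> n; have [up pv] := Dedge n uv t01 pE.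
rewrite /M ge_max; apply/andP; split.
  apply/andP; split; first by have := Dtri n p (vertex u) q; rewrite up; lra.
  by have := Dtri n p (vertex v) q; rewrite (Dsym n (vertex v) p) pv; lra.
rewrite -lerBlDr le_max; have := D4 n p q (vertex u) (vertex v).
rewrite -lerBlDr le_max (Dsym n p (vertex u)) up pv (Dsym n q) (Dsym n q) => /orP[] h;
  apply/orP; [right|left]; lra.
Unshelve. all: by end_near. Qed.

Lemma limit_pseudo_metric : exists dbar : pseudo_metric R K,
  forall p q, (fun n => D n p q) @ \oo --> dbar p q.
Proof.
have /choice[f fP] : forall pq : K * K, exists L : R, (fun n => D n pq.1 pq.2) @ \oo --> L.
  move=> [p q]; apply: Dcvg_from_vertices => w /=.
  have [L hL] := Dcvg_from_vertices (fun u => Dvertex u w) q.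
  by exists L; under eq_fun do rewrite Dsym.
have fxx p : f (p, p) = 0.
  apply: (cvg_seq_unique (fP (p, p))) => /=.
  by under eq_fun do rewrite Dxx; exact: cvg_cst.
have fsym p q : f (p, q) = f (q, p).
  apply: (cvg_seq_unique (fP (p, q))) => /=.
  by under eq_fun do rewrite Dsym; exact: (fP (q, p)).
have ftri q p r : f (p, r) <= f (p, q) + f (q, r).
  apply: (ler_cvg_to (fP (p, r)) (cvgD (fP (p, q)) (fP (q, r)))).
  by apply: nearW => n /=; exact: Dtri.
by exists (PseudoMetricOn fxx fsym ftri) => p q; exact: (fP (p, q)).
Qed.

Context (dbar : pseudo_metric R K).
Context (Ddbar : forall p q, (fun n => D n p q) @ \oo --> dbar p q).
Arguments Ddbar : clear implicits.
Local Notation Gamma := (associated_space dbar).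

Lemma quot_mapP (y : Gamma) : exists p, y = quot_map dbar p.
Proof. by exists (repr y); rewrite /quot_map reprK. Qed.

Lemma quot_map_eq p q : dbar p q = 0 -> quot_map dbar p = quot_map dbar q.
Proof. by move=> pq; apply: mdist_positivity; rewrite mdist_quot_map. Qed.

Lemma limit_four_point : four_point Gamma 0.
Proof.
move=> x y z w.
have [p ->] := quot_mapP x; have [q ->] := quot_mapP y.
have [r ->] := quot_mapP z; have [s ->] := quot_mapP w.
rewrite !mdist_quot_map !addr0.
suff : dbar p q + dbar r s <= Num.max (dbar p r + dbar q s) (dbar p s + dbar q r).
  by rewrite le_max => /orP.
have c1 : (fun n => D n p q + D n r s) @ \oo --> dbar p q + dbar r s by exact: cvgD.
have c2 : (fun n => Num.max (D n p r + D n q s) (D n p s + D n q r) + e n) @ \oo -->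
    Num.max (dbar p r + dbar q s) (dbar p s + dbar q r).
  rewrite -[X in _ --> X]addr0; apply: cvgD => //.
  by apply: cvg_maxr; exact: cvgD.
by apply: (ler_cvg_to c1 c2); apply: nearW => n; exact: D4.
Qed.

Lemma limit_straight u v (s t : R) p q : u != v -> s \in `[0, 1] -> t \in `[0, 1] ->
  val p = bary u v s -> val q = bary u v t ->
  dbar p q = `|s - t| * dbar (vertex u) (vertex v).
Proof.
move=> uv sin tin ps qt; apply: (cvg_seq_unique (Ddbar p q)).
under eq_fun do rewrite (Dstraight _ uv sin tin ps qt).
exact: cvgMr.
Qed.

(** Edges of the graph become segments, possibly reduced to points, and [joined_trans] replaces a
    chain of edges by one segment. *)
Lemma limit_joined (x y : Gamma) : joined x y.
Proof.
have edge u v t p : u != v -> 0 <= t <= 1 -> val p = bary u v t ->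
    joined (quot_map dbar (vertex u)) (quot_map dbar p).
  move=> uv t01 pE r; rewrite mdist_quot_map => /andP[r0 rl].
  have /andP[t0 t1] := t01.
  have i0 : (0 : R) \in `[0, 1] by rewrite in_itv/= lexx ler01.
  have it : t \in `[0, 1] by rewrite in_itv.
  have v0 : val (vertex u : K) = bary u v 0 by rewrite bary0.
  have pl := limit_straight uv i0 it v0 pE.
  rewrite sub0r normrN ger0_norm// in pl.
  have [l0|ln0] := eqVneq (dbar (vertex u) (vertex v)) 0.
    exists (quot_map dbar (vertex u)); split; last exact: betweenL.
    by rewrite mdist0; apply/eqP; rewrite eq_le r0/= (le_trans rl)// pl l0 mulr0.
  have lp : 0 < dbar (vertex u) (vertex v) by rewrite lt_neqAle eq_sym ln0 pdist_ge0.
  have rt : r / dbar (vertex u) (vertex v) <= t by rewrite ler_pdivrMr// -pl.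
  have rge : 0 <= r / dbar (vertex u) (vertex v) by rewrite divr_ge0// ltW.
  have [|z zE] := @edge_point R G u v (r / dbar (vertex u) (vertex v)) uv.
    by rewrite rge (le_trans rt).
  have iz : r / dbar (vertex u) (vertex v) \in `[0, 1].
    by rewrite in_itv/= rge (le_trans rt).
  have zl := limit_straight uv i0 iz v0 zE.
  have zp := limit_straight uv iz it zE pE.
  rewrite sub0r normrN ger0_norm// divfK// in zl.
  rewrite distrC ger0_norm ?subr_ge0// mulrBl divfK// in zp.
  exists (quot_map dbar z); rewrite /between !mdist_quot_map zl zp pl.
  by split=> //; lra.
have vv u v : joined (quot_map dbar (vertex u)) (quot_map dbar (vertex v)).
  have [->|uv] := eqVneq u v.
    move=> r; rewrite mdist0 => r0; exists (quot_map dbar (vertex v)); split.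
      by rewrite mdist0; apply/eqP; rewrite eq_le.
    exact: betweenL.
  by apply: (edge u v 1) => //; rewrite ?bary1// lexx ler01.
have pv p u : joined (quot_map dbar p) (quot_map dbar (vertex u)).
  have [[v ->//]|[v [w [t [vw t01 pE]]]]] := realization_cases p.
  apply: (joined_trans limit_four_point _ (vv v u)).
  by apply: joined_sym; exact: edge pE.
have [p ->] := quot_mapP x; have [q ->] := quot_mapP y.
apply: (joined_trans limit_four_point (pv p 1%g)); apply: joined_sym; exact: pv.
Qed.

Lemma limit_invariant g p q : dbar (left_mul g p) (left_mul g q) = dbar p q.
Proof.
apply: (cvg_seq_unique (Ddbar (left_mul g p) (left_mul g q))).
by under eq_fun do rewrite Dinv; exact: Ddbar.
Qed.

Definition limit_act g (y : Gamma) : Gamma := quot_map dbar (left_mul g (repr y)).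

Lemma limit_act_quot g p : limit_act g (quot_map dbar p) = quot_map dbar (left_mul g p).
Proof.
apply: quot_map_eq; rewrite limit_invariant -mdist_quot_map.
by rewrite /quot_map reprK mdist0.
Qed.

Lemma limit_act_isometric : isometric_action limit_act.
Proof.
split.
- by move=> y; have [p ->] := quot_mapP y; rewrite limit_act_quot left_mul1.
- by move=> g h y; have [p ->] := quot_mapP y; rewrite !limit_act_quot left_mulM.
- move=> g y z; have [p ->] := quot_mapP y; have [q ->] := quot_mapP z.
  by rewrite !limit_act_quot !mdist_quot_map limit_invariant.
Qed.

End LimitPseudoMetric.

(** * Rescaling by the displacement of the approximate center *)

Section Rescaling.
Context {R : realType} {G : groupType} (S : seq G).
Context (X : nat -> metricType R) (rho : forall n, G -> X n -> X n) (x : forall n, X n).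
Arguments rho : clear implicits.
Context (gS : generates S) (rhoA : forall n, isometric_action (rho n)).
Context (rho_center : forall n, approximate_center S (rho n) (x n)).
Implicit Types (g h : G).

Local Notation r n := (displacement S (rho n) (x n)).

Lemma displacement_ge0 n : 0 <= r n.
Proof. exact: bigmax_ge_id. Qed.

(** The translation length of [alpha] is at most the displacement of [x n] by [alpha], hence at most
    a fixed multiple of [r n]. *)
Lemma displacement_cvgy : blows_up rho -> (fun n => r n) @ \oo --> +oo.
Proof.
move=> [alpha /cvgryPge ha]; have [C C0 aC] := displacement_bound x gS rhoA alpha.
have C1 : 0 < C + 1 by rewrite ltr_wpDl.
apply/cvgryPge => A; apply: filterS (ha (A * (C + 1))) => n tn.
rewrite -(ler_pM2r C1) (le_trans tn)// (le_trans (translation_length_le _ (x n)))//.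
rewrite (le_trans (aC n))// mulrC ler_wpM2l ?displacement_ge0//.
by rewrite lerDl.
Qed.

End Rescaling.

Section MetricRescaling.
Context {R : realType} {X : metricType R}.

Lemma four_point_rescale (e c : R) (x y z w : X) : 0 <= c -> four_point X e ->
  c * mdist x y + c * mdist z w <=
  Num.max (c * mdist x z + c * mdist y w) (c * mdist x w + c * mdist y z) + c * e.
Proof.
move=> c0 h4; rewrite -lerBlDr le_max -!mulrDr -mulrBr; apply/orP.
by case: (h4 x y z w) => h; [left|right]; rewrite ler_wpM2l// lerBlDr.
Qed.

End MetricRescaling.

Lemma cvg_bigmaxr (R : realType) (T : eqType) (r : seq T) (u : nat -> T -> R) :
  (forall t, t \in r -> (fun n => u n t) @ \oo --> 0) ->
  (fun n => \big[Num.max/0]_(t <- r) u n t) @ \oo --> 0.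
Proof.
elim: r => [|t r ih] ur.
  by under eq_fun do rewrite big_nil; exact: cvg_cst.
under eq_fun do rewrite big_cons.
have ut : (fun n => u n t) @ \oo --> 0 by apply: ur; rewrite mem_head.
have := cvg_maxr ut (ih _); rewrite maxxx; apply=> s sr.
by apply: ur; rewrite in_cons sr orbT.
Qed.

Theorem proposition3p3 (R : realType) (G : groupType) (S : seq G) (Delta : R)
    (H : nat -> metricType R) (rho : forall n, G -> H n -> H n)
    (x : forall n, H n) (iota : forall n, realization R (@complete_graph G) -> H n) :
  generates S ->
  0 < Delta ->
  (forall n, geodesic_space (H n) /\ thin_triangles Delta (H n)) ->
  (forall n, isometric_action (rho n)) ->
  blows_up rho ->
  (forall n, approximate_center S (rho n) (x n)) ->
  (forall n g p, iota n (left_mul g p) = rho n g (iota n p)) ->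
  (forall n, straight (iota n)) ->
  (forall n g, iota n (vertex g) = rho n g (x n)) ->
  exists (phi : nat -> nat) (lambda : nat -> R)
      (dbar : pseudo_metric R (realization R (@complete_graph G)))
      (sigma : G -> associated_space dbar -> associated_space dbar),
    [/\ {homo phi : m n / (m < n)%N},
        lambda @ \oo --> 0
      & forall p q, (fun n => lambda n * mdist (iota (phi n) p) (iota (phi n) q))
          @ \oo --> dbar p q] /\
    [/\ R_tree (associated_space dbar),
        isometric_action sigma,
        forall g p, sigma g (quot_map dbar p) = quot_map dbar (left_mul g p),
        exists g, hyperbolic (sigma g)
      & cvg_PLF (fun n => length_function (rho (phi n))) (length_function sigma)] /\
    (irreducible sigma ->
     (forall g, length_function sigma g \is a Num.int) ->
     exists T : set (associated_space dbar),
       [/\ minimal_invariant_subtree sigma T,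
           forall T', minimal_invariant_subtree sigma T' -> T' = T
         & exists tau : G -> T -> T,
             [/\ forall g y, set_val (tau g y) = sigma g (set_val y),
                 simplicial_tree_action tau
               & length_function tau = length_function sigma]]).
Proof.
move=> gS D0 geo rhoA blow center iotaE straight_iota iotaV.
have h4 n : four_point (H n) (8 * Delta) by have [? ?] := geo n; exact: thin_four_point.
pose r n := displacement S (rho n) (x n).
have r_ge0 n : 0 <= r n by exact: displacement_ge0.
have r_y : r @ \oo --> +oo by exact: displacement_cvgy.
have [alpha alpha_y] := blow.
(* From [N0] on, [r n] can be inverted and [alpha] witnesses that the length function is not zero,
   as projective convergence requires at every index. *)
have [N0 N0P] : exists N0, forall n, (N0 <= n)%N ->
    1 <= translation_length (rho n alpha) /\ 0 < r n.
  move/cvgryPge : alpha_y => /(_ 1)[N1 _ h1].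
  move/cvgryPge : r_y => /(_ 1)[N2 _ h2].
  exists (maxn N1 N2) => n; rewrite geq_max => /andP[n1 n2].
  by split; [exact: h1|rewrite (lt_le_trans ltr01)//; exact: h2].
have [enum enumP] := generated_countable gS.
have /choice[C CP] : forall g, exists C : R, forall n,
    `|(r n)^-1 * mdist (x n) (rho n g (x n))| <= C.
  move=> g; have [C C0 gC] := displacement_bound x gS rhoA g.
  exists C => n; rewrite ger0_norm; last by rewrite mulr_ge0 ?invr_ge0 ?mdist_ge0.
  (* Before [N0] the value [r n] may vanish; its inverse is then 0 and the bound still holds. *)
  have [rn0|rn0] := eqVneq (r n) 0; first by rewrite rn0 invr0 mul0r.
  by rewrite mulrC ler_pdivrMr ?gC// lt_neqAle eq_sym rn0 r_ge0.
have [phi [phi_homo phi_N0 phi_cvg]] :=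
  extract_subsequence N0 enumP (fun n g => CP g n).
pose lambda n := (r (phi n))^-1.
have r_gt0 n : 0 < r (phi n) by have [] := N0P _ (phi_N0 n).
have lambda_gt0 n : 0 < lambda n by rewrite invr_gt0.
have lambda_ge0 n : 0 <= lambda n by exact: ltW.
have phi_oo : phi @ \oo --> \oo.
  move=> A [N _ NA]; exists N => // n Nn; apply: NA.
  have phi_ge m : (m <= phi m)%N.
    by elim: m => // m ih; rewrite (leq_ltn_trans ih)// phi_homo.
  exact: leq_trans (phi_ge n).
have lambda0 : lambda @ \oo --> 0.
  apply/gtr0_cvgV0; first exact: nearW.
  exact: cvg_comp phi_oo r_y.
pose D n p q := lambda n * mdist (iota (phi n) p) (iota (phi n) q).
pose e n := lambda n * (8 * Delta).
have Dxx n p : D n p p = 0 by rewrite /D mdist0 mulr0.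
have Dsym n p q : D n p q = D n q p by rewrite /D mdistC.
have Dtri n q p s : D n p s <= D n p q + D n q s.
  by rewrite /D -mulrDr ler_wpM2l// mdist_tri.
have D4 n p q s t : D n p q + D n s t <=
    Num.max (D n p s + D n q t) (D n p t + D n q s) + e n.
  exact: four_point_rescale.
have De : e @ \oo --> 0.
  by rewrite -[X in _ --> X](mul0r (8 * Delta)); apply: cvgMl.
have Dstraight n u v (s t : R) (p q : realization R (@complete_graph G)) : u != v ->
    s \in `[0, 1] -> t \in `[0, 1] -> val p = bary u v s -> val q = bary u v t ->
    D n p q = `|s - t| * D n (vertex u) (vertex v).
  by move=> uv s01 t01 ps qt; rewrite /D (straight_iota _ u v s t p q)// mulrCA.
have Dinv n g p q : D n (left_mul g p) (left_mul g q) = D n p q.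
  by rewrite /D !iotaE (actd (rhoA _)).
have Dv n g : D n (vertex 1%g) (vertex g) =
    lambda n * mdist (x (phi n)) (rho (phi n) g (x (phi n))).
  by rewrite /D !iotaV (act1 (rhoA _)).
(* By equivariance the pair [u], [v] reduces to [1], [u^-1 * v], so one sequence per group element
   suffices. *)
have Dvertex u v : exists L : R, (fun n => D n (vertex u) (vertex v)) @ \oo --> L.
  have [L hL] := phi_cvg (u^-1 * v)%g; exists L.
  have -> : (fun n => D n (vertex u) (vertex v)) =
      (fun n => lambda n * mdist (x (phi n)) (rho (phi n) (u^-1 * v)%g (x (phi n)))).
    apply/funext => n; rewrite -Dv -(Dinv n u (vertex 1%g)) !left_mul_vertex.
    by rewrite mulg1 mulVKg.
  exact: hL.
have [dbar Ddbar] := limit_pseudo_metric Dxx Dsym Dtri D4 De Dstraight Dvertex.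
have G4 := limit_four_point D4 De Ddbar.
have Gj := limit_joined D4 De Dstraight Ddbar.
have sigmaA := limit_act_isometric Dinv Ddbar.
have sigma_quot := limit_act_quot Dinv Ddbar.
set sigma := @limit_act R G dbar in sigmaA sigma_quot.
(* A common fixed point in the limit would contradict that the displacement of
   [x n] is minimal up to 1. *)
have no_fixed p : exists2 s, s \in S & quot_map dbar (left_mul s p) <> quot_map dbar p.
  apply: contrapT => fixp.
  have Dfix s : s \in S -> (fun n => D n p (left_mul s p)) @ \oo --> 0.
    move=> sin; have -> : 0 = dbar p (left_mul s p); last exact: Ddbar.
    rewrite -mdist_quot_map.
    have -> : quot_map dbar (left_mul s p) = quot_map dbar p.
      by apply: contrapT => ne; apply: fixp; exists s.
    by rewrite mdist0.
  have max0 := cvg_bigmaxr Dfix.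
  have : 1 <= (0 : R).
    have c1 : (fun n => \big[Num.max/0]_(s <- S) D n p (left_mul s p) + lambda n) @ \oo --> (0 : R).
      by rewrite -[X in _ --> X]addr0; exact: cvgD.
    have c0 : (fun=> 1 : R) @ \oo --> (1 : R) by exact: cvg_cst.
    apply: (ler_cvg_to c0 c1); apply: nearW => n /=.
    have := center (phi n) (iota (phi n) p); rewrite -/(r _) => rc.
    have -> : 1 = lambda n * r (phi n) by rewrite mulVf// gt_eqF.
    rewrite (le_trans (ler_wpM2l (lambda_ge0 n) rc))// mulrDr mulr1 lerD2r.
    rewrite -ler_pdivlMl// /displacement big_seq; apply: bigmax_le.
      by rewrite mulr_ge0 ?invr_ge0//; exact: bigmax_ge_id.
    move=> s sS; rewrite ler_pdivlMl// -iotaE.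
    exact: (@le_bigmax_seq _ _ _ _ 0 s xpredT).
  by rewrite ler10.
have [g g_hyp] : exists g, 0 < translation_length (sigma g).
  apply: contrapT => no_hyp.
  have t0 k : translation_length (sigma k) = 0.
    apply/eqP; rewrite eq_le leNgt; apply/andP; split.
      by apply/negP => tk; apply: no_hyp; exists k.
    apply: (translation_length_ge (quot_map dbar (vertex 1%g))) => y.
    exact: mdist_ge0.
  have [m mfix] := common_fixed_point G4 Gj sigmaA S (quot_map dbar (vertex 1%g)) t0.
  have [p mE] := quot_mapP m; have [s sS] := no_fixed p.
  by rewrite -sigma_quot -mE mfix.
exists phi, lambda, dbar, sigma; split; first by split.
split; last first.
  by move=> irr int_length; exact: irreducible_integral_simplicial.
split=> //.
- exact: R_tree_of_four_point.
- by exists g; exact: hyperbolic_act.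
split.
- by move=> n; exists alpha => h; have [] := N0P _ (phi_N0 n);
    rewrite -/(length_function _ alpha) h ler10.
- by exists g; apply/eqP; rewrite gt_eqF.
exists lambda; split; first by move=> n; apply/eqP; rewrite gt_eqF.
move=> k; rewrite /length_function.
(* At the base vertex the formula for the length is exact in the limit and holds up to multiples of
   [e n] before it, which squeezes the rescaled lengths. *)
rewrite (translation_length_act G4 Gj sigmaA k (quot_map dbar (vertex 1%g))).
rewrite !sigma_quot !left_mul_vertex mulg1 !mdist_quot_map.
pose a n := D n (vertex 1%g) (vertex k); pose b n := D n (vertex 1%g) (vertex (k * k)%g).
have cab : (fun n => Num.max 0 (b n - a n)) @ \oo -->
    Num.max 0 (dbar (vertex 1%g) (vertex (k * k)%g) - dbar (vertex 1%g) (vertex k)).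
  by apply: cvg_maxr; [exact: cvg_cst|apply: cvgB; exact: Ddbar].
have bounds n : Num.max 0 (b n - a n) - e n <= lambda n * translation_length (rho (phi n) k)
    <= Num.max 0 (b n - a n) + 2 * e n.
  (* The midpoint is the image of the middle of the edge from [1] to [k], by straightness; for
     [k = 1] there is no edge and [x (phi n)] itself serves. *)
  have [m [mb m2]] : exists m, between (x (phi n)) m (rho (phi n) k (x (phi n))) /\
      mdist (x (phi n)) m = mdist (x (phi n)) (rho (phi n) k (x (phi n))) / 2.
    have [->|k1] := eqVneq k 1%g.
      exists (x (phi n)); rewrite (act1 (rhoA _)) mdist0 mul0r; split=> //.
      exact: betweenL.
    have uk : 1%g != k :> G by rewrite eq_sym.
    have half01 : 0 <= (1 / 2 : R) <= 1 by apply/andP; split; lra.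
    have [p pE] := edge_point uk half01.
    have i0 : (0 : R) \in `[0, 1] by rewrite in_itv/= lexx ler01.
    have i1 : (1 : R) \in `[0, 1] by rewrite in_itv/= lexx ler01.
    have ih : (1 / 2 : R) \in `[0, 1] by rewrite in_itv.
    have v0 : val (vertex 1%g : realization R (@complete_graph G)) = bary 1%g k 0.
      by rewrite bary0.
    have v1 : val (vertex k : realization R (@complete_graph G)) = bary 1%g k 1.
      by rewrite bary1.
    have := straight_iota (phi n) _ _ _ _ _ _ uk i0 ih v0 pE.
    have := straight_iota (phi n) _ _ _ _ _ _ uk ih i1 pE v1.
    rewrite !iotaV (act1 (rhoA _)) sub0r normrN => e1 e2.
    rewrite ger0_norm in e2; last lra.
    rewrite ler0_norm in e1; last lra.
    exists (iota (phi n) p); rewrite /between e1 e2; split; lra.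
  have := translation_length_bounds (actd (rhoA (phi n)) k) (h4 (phi n)) mb m2.
  have -> : Num.max 0 (b n - a n) = lambda n * Num.max 0
      (mdist (x (phi n)) (rho (phi n) k (rho (phi n) k (x (phi n))))
       - mdist (x (phi n)) (rho (phi n) k (x (phi n)))).
    by rewrite maxr_pMr// mulr0 mulrBr /a /b !Dv (actM (rhoA _)).
  rewrite /e => /andP[h1 h2]; apply/andP; split.
    by rewrite -mulrBr ler_wpM2l.
  by rewrite mulrCA -mulrDr ler_wpM2l.
apply: (squeeze_cvgr (nearW _ bounds)).
  by rewrite -[X in _ --> X]subr0; exact: cvgB.
rewrite -[X in _ --> X]addr0; apply: cvgD => //.
by rewrite -(mulr0 2); exact: cvgMr.
Qed.
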